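(* Let $\langle\mu,d\rangle$ be a generating tuple on a finite vertex set $V$ whose weights are degree-monotone. Then $$\operatorname{Argmin}_{T\in\mathcal{T}(\mu,d)} VWWI(T)=\mathcal{TH}(\mu,d),$$ i.e., a tree $T\in\mathcal{T}(\mu,d)$ minimizes $VWWI$ over $\mathcal{T}(\mu,d)$ if and only if $T$ is a Huffman tree generated by $\langle\mu,d\rangle$.
   Context: **Generating tuples.** A generating tuple $\langle\mu,d\rangle$ on a finite vertex set $V$ consists of a weight function $\mu:V\to[0,\infty)$ and a degree function $d:V\to\{1,2,3,\dots\}$ with $\sum_{v\in V}d(v)=2(|V|-1)$. Put $W=W(\mu,d):=\{v\in V:d(v)=1\}$ (pendent vertices) and $M=M(\mu,d):=V\setminus W$ (internal vertices). Throughout $|W|\ge 2$ and $q:=|M|\ge 1$. $\mathcal{T}(\mu,d)$ is the set of all (undirected, vertex-weighted) trees $T$ with vertex set $V$ in which each $v\in V$ has degree $d(v)$ and weight $\mu(v)$. **Wiener index.** For $T\in\mathcal{T}(\mu,d)$, $VWWI(T):=\frac12\sum_{u,v\in V}\mu(u)\mu(v)d_T(u,v)$, where $d_T(u,v)$ is the number of edges of the path between $u$ and $v$ in $T$. **Degree-monotone weights.** The weights in $\langle\mu,d\rangle$ are degree-monotone if (i) for all $m,m'\in M$, $d(m)<d(m')$ implies $\mu(m)\le\mu(m')$, and (ii) $\mu(v)>0$ for every $v\in W$. **Minimal stars.** A star is a complete bipartite graph $K_{1,k}$ with a distinguished vertex, the center, connected to $k$ other vertices, the leaves; $L(S)$ is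 the set of leaves of a star $S$, $V(S)$ its vertex set, $E(S)$ its edge set. For a generating tuple $\langle\mu,d\rangle$ with degree-monotone weights, a minimal star is a star $S$ whose center $m\in M$ has the least degree among the internal vertices of least weight, i.e. $m\in\operatorname{Argmin}\{d(u):u\in\operatorname{Argmin}_{v\in M}\mu(v)\}$, and which has exactly $d(m)-1$ leaves, with $L(S)\subseteq W$ and $\mu(u)\le\mu(v)$ for all $u\in L(S)$, $v\in W\setminus L(S)$ (weights in $S$ are those given by $\mu$). **Huffman trees (generalized Huffman algorithm).** Set $V_1:=V$, $\mu^1:=\mu$, $d^1:=d$. For $i=1,\dots,q-1$ let $S_i$ be any minimal star for $\langle\mu^i,d^i\rangle$, with center $m_i$; set $V_{i+1}:=V_i\setminus L(S_i)$ and, on $V_{i+1}$, $\mu^{i+1}(v):=\mu^i(v)$ and $d^{i+1}(v):=d^i(v)$ for $v\ne m_i$, $\mu^{i+1}(m_i):=\sum_{v\in V(S_i)}\mu^i(v)$, $d^{i+1}(m_i):=1$. Finally let $m_q$ be the unique element of $M(\mu^q,d^q)$ and let $S_q$ be the star with vertex set $V_q$ and center $m_q$. The resulting Huffman tree $H$ has vertex set $V$, edge set $E(S_1)\cup\dots\cup E(S_q)$ and weights $\mu$. $\mathcal{TH}(\mu,d)\subseteq\mathcal{T}(\mu,d)$ is the set of all Huffman trees obtainable in this way (over all possible choices of minimal stars). *)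

(* Defs.v *)
From mathcomp Require Import all_boot all_order all_algebra.

Set Implicit Arguments.
Unset Strict Implicit.
Unset Printing Implicit Defensive.

Import Order.TTheory GRing.Theory Num.Theory.
Local Open Scope ring_scope.

Definition is_argmin (I : Type) (disp : Order.disp_t) (T : porderType disp)
    (P : I -> Prop) (f : I -> T) (x : I) : Prop :=
  P x /\ forall y, P y -> (f x <= f y)%O.

Section Graphs.
Variable V : finType.
Implicit Types (E : {set {set V}}) (u v : V).

(* A simple graph with vertex set V is given by its set of edges, each edge   *)
(* being a two-element set of vertices; [is_tree] imposes the latter.         *)
Definition adj E : rel V := fun u v => [set u; v] \in E.

Definition degree E v : nat := #|[set u | adj E v u]|.

Record is_tree E : Prop := IsTree {
  tree_edges : forall e, e \in E -> #|e| = 2;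
  tree_connected : forall u v, connect (adj E) u v;
  tree_acyclic : forall c : seq V, (2 < size c)%N -> ~ ucycle (adj E) c }.

(* Length of a simple path from u to v (#|V| if there is none).  In a tree    *)
(* there is exactly one such path, so that the n found is its edge count.     *)
Definition tree_dist E u v : nat :=
  find (fun n => [exists p : n.-tuple V,
                    [&& path (adj E) u p, uniq (u :: p) & last u p == v]])
       (iota 0 #|V|).

(* The vertices always keep their prescribed weights, so a vertex-weighted    *)
(* tree realizing a generating tuple is determined by its edges.              *)
Definition realizes (d : V -> nat) E : Prop :=
  is_tree E /\ forall v, degree E v = d v.

End Graphs.

Section Weights.
Variables (R : realFieldType) (V : finType).
Implicit Types (E : {set {set V}}) (A L : {set V}) (mu : V -> R) (d : V -> nat).

Definition VWWI mu E : R :=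
  2%:R^-1 * \sum_(u : V) \sum_(v : V) mu u * mu v * (tree_dist E u v)%:R.

(* Below, A is the current vertex set: the Huffman algorithm removes vertices *)
(* from it, and the values of mu and d outside A are irrelevant.              *)
Definition pendent A d : {set V} := [set v in A | d v == 1%N].

Definition internal A d : {set V} := A :\: pendent A d.

Definition generating_tuple mu d : Prop :=
  [/\ forall v, 0 <= mu v,
      forall v, (0 < d v)%N
    & (\sum_(v : V) d v = 2 * (#|V| - 1))%N].

Definition degree_monotone mu d : Prop :=
  (forall m m', m \in internal [set: V] d -> m' \in internal [set: V] d ->
     (d m < d m')%N -> mu m <= mu m') /\
  (forall v, v \in pendent [set: V] d -> 0 < mu v).

(* A star is given by its center m and its set of leaves L.                   *)
Definition star_edges (m : V) L : {set {set V}} := [set [set m; l] | l in L].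

Definition minimal_star A mu d (m : V) L : Prop :=
  [/\ is_argmin (is_argmin (fun v => v \in internal A d) mu) d m,
      #|L| = (d m - 1)%N,
      L \subset pendent A d
    & forall u v, u \in L -> v \in pendent A d :\: L -> mu u <= mu v].

Definition merge_weight mu (m : V) L : V -> R :=
  fun v => if v == m then \sum_(u in m |: L) mu u else mu v.

Definition merge_degree d (m : V) : V -> nat :=
  fun v => if v == m then 1%N else d v.

(* [huffman A mu d E]: some run of the algorithm started from the generating  *)
(* tuple (mu, d) on A outputs the edge set E.                                 *)
Inductive huffman : {set V} -> (V -> R) -> (V -> nat) -> {set {set V}} -> Prop :=
| HuffmanLast A mu d m :
    internal A d = [set m] ->
    huffman A mu d (star_edges m (A :\ m))
| HuffmanStep A mu d m L E :
    (1 < #|internal A d|)%N ->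
    minimal_star A mu d m L ->
    huffman (A :\: L) (merge_weight mu m L) (merge_degree d m) E ->
    huffman A mu d (star_edges m L :|: E).

Definition huffman_tree mu d E : Prop := huffman [set: V] mu d E.

End Weights.

(* Main.v *)
Require Import Defs.
From mathcomp Require Import all_boot all_order all_algebra.
From mathcomp Require Import perm zify ring lra.

(* Let D(a) be the mu-weighted sum of the distances to a.  Moving weight w     *)
(* from a to b changes the index by w (D(b) - D(a)) - w^2 d(a,b), and so does *)
(* moving a branch of weight w.  Hence, in an optimal tree, the internal      *)
(* vertex m with the largest D has the least weight and, for that weight, the *)
(* least degree: otherwise exchange its label with that of a nearer vertex    *)
(* and send the excess branches along.  Its pendent neighbours are lightest   *)
(* for the same reason.  As D is convex along paths, m (suitably chosen among *)
(* the maximizers) has a single internal neighbour, so every                  *)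
(* optimal tree contains a minimal star, and permuting vertices of equal      *)
(* weight and degree turns it into any prescribed one.  Collapsing a minimal  *)
(* star changes the index by a constant, whence an induction on the number    *)
(* of internal vertices.                                                      *)
(*                                                                            *)
(* Trees are handled through their distance function: seen from v, each       *)
(* vertex u != v has exactly one neighbour closer to v, all others being      *)
(* farther.  Surgery on trees then reduces to checking this property of an    *)
(* explicit distance function, without paths or cycles.                       *)

Set Implicit Arguments.
Unset Strict Implicit.
Unset Printing Implicit Defensive.

Import Order.TTheory GRing.Theory Num.Theory.

(** * Trees as distance functions *)

(** Optimal trees and runs of the algorithm are matched star by star. On one side, every optimal
    tree contains some minimal star ([optimal_minimal_star]). The exact effect on the cost of
    swapping two weights and of moving a branch is given by [dist_cost_tperm] and [dist_cost_move].
    Combined so as to preserve all prescribed degrees, these exchanges show that an internal vertex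
    of largest transmission is lightest and then of least degree ([optimal_no_swap],
    [optimal_far_center]), with lightest pendent neighbours ([optimal_far_pendent]), while
    [transmission_convex] leaves it a single internal neighbour.

    On the other side, collapsing a given minimal star shifts the cost of all trees containing it by
    the same constant ([dist_cost_star]) and yields again a degree-monotone tuple ([tuple_merge]).
    Optimality therefore survives the collapse ([optimal_remove_star]). Conversely, whichever
    minimal star the algorithm picks, some optimal tree contains it ([optimal_with_star]), so
    re-expanding an optimal collapsed tree is optimal ([optimal_add_star]). The induction is
    [optimal_huffman], and its base case is [realizes_one_internal]. *)

Ltac nat_lia :=
  repeat match goal with
  | H : _ = _ :> ?T |- _ => unify T nat; revert H
  | H : is_true (leq _ _) |- _ => revert H
  | H : _ \/ _ |- _ => revert H
  end; clear; lia.

Section TreeMetric.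
Variable V : finType.
Implicit Types (A L X : {set V}) (E : {set {set V}}) (dist : V -> V -> nat).
Implicit Types (a b m u v w x y : V).

(** Trees are taken relative to a vertex set [A], because collapsing a star deletes vertices; [dist]
    is unconstrained outside [A]. The last field encodes both halves of being a tree: following
    parents connects [u] to [v], and uniqueness of the parent forbids cycles. *)
Record tree_metric A E dist : Prop := TreeMetric {
  tm_edge : forall e, e \in E -> (e \subset A) && (#|e| == 2);
  tm_id : forall u, u \in A -> dist u u = 0;
  tm_sym : forall u v, u \in A -> v \in A -> dist u v = dist v u;
  tm_parent : forall u v, u \in A -> v \in A -> u != v ->
    exists w, [/\ adj E u w, dist u v = (dist w v).+1
                & forall w', adj E u w' -> w' != w -> dist w' v = (dist u v).+1]
}.

Lemma adj_sym E u v : adj E u v = adj E v u.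
Proof. by rewrite /adj setUC. Qed.

Lemma cards2_eq2 u v : (#|[set u; v]| == 2) = (u != v).
Proof. by rewrite cards2; case: (u != v). Qed.

Section Basics.
Variables (A : {set V}) (E : {set {set V}}) (dist : V -> V -> nat).
Hypothesis tmE : tree_metric A E dist.

Lemma adj_memr u v : adj E u v -> v \in A.
Proof.
move=> /(tm_edge tmE)/andP[/subsetP sub _]; apply: sub.
by rewrite !inE eqxx orbT.
Qed.

Lemma adj_meml u v : adj E u v -> u \in A.
Proof. by rewrite adj_sym => /adj_memr. Qed.

Lemma adj_neq u v : adj E u v -> u != v.
Proof. by move=> /(tm_edge tmE)/andP[_]; rewrite cards2_eq2. Qed.

Lemma dist_gt0 u v : u \in A -> v \in A -> u != v -> 0 < dist u v.
Proof. by move=> uA vA /(tm_parent tmE uA vA)[w [_ -> _]]. Qed.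

Lemma dist_adj u w v : v \in A -> adj E u w ->
  dist w v = (dist u v).+1 \/ dist u v = (dist w v).+1.
Proof.
move=> vA uw; have uA := adj_meml uw; have wA := adj_memr uw.
have [euv|nuv] := eqVneq u v.
  (* Here [u] itself is the target and has no parent; the parent of [w] must then be [u], since any
     other choice would put [u] at positive distance from itself. *)
  rewrite -euv; left; rewrite (tm_id tmE uA).
  have [|p [_ dp others]] := tm_parent tmE wA uA; first by rewrite eq_sym adj_neq.
  rewrite dp; have [<-|nup] := eqVneq u p; first by rewrite (tm_id tmE uA).
  have := others u; rewrite adj_sym (tm_id tmE uA) => /(_ uw nup); nat_lia.
have [p [up dp others]] := tm_parent tmE uA vA nuv.
by have [->|nwp] := eqVneq w p; [right | left; apply: others].
Qed.

Lemma parent_uniq u v w w' : u \in A -> v \in A -> adj E u w -> adj E u w' ->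
  dist u v = (dist w v).+1 -> dist u v = (dist w' v).+1 -> w = w'.
Proof.
move=> uA vA uw uw' dw dw'.
have nuv : u != v.
  by apply: contra_eq_neq dw => ->; rewrite (tm_id tmE vA).
have [p [up _ others]] := tm_parent tmE uA vA nuv.
have is_p z : adj E u z -> dist u v = (dist z v).+1 -> z = p.
  by move=> uz dz; apply/eqP/contraT => /(others z uz); nat_lia.
by rewrite (is_p w) // (is_p w').
Qed.

Lemma adj_dist1 u v : u \in A -> v \in A -> adj E u v = (dist u v == 1).
Proof.
move=> uA vA; apply/idP/eqP => [uv|duv].
  by have := dist_adj uA uv; rewrite (tm_id tmE uA) (tm_sym tmE uA vA); nat_lia.
have nuv : u != v by apply: contra_eq_neq duv => ->; rewrite (tm_id tmE vA).
have [p [up dp _]] := tm_parent tmE uA vA nuv.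
have [<- //|npv] := eqVneq p v.
have := dist_gt0 (adj_memr up) vA npv; nat_lia.
Qed.

Lemma dist_pendent u p v : adj E u p -> degree E u = 1 -> v \in A -> v != u ->
  dist u v = (dist p v).+1.
Proof.
move=> up /eqP/cards1P[z zE] vA nvu.
have [|w [uw -> _]] := tm_parent tmE (adj_meml up) vA; first by rewrite eq_sym.
have mem t : adj E u t -> t = z.
  by move=> ut; apply/eqP; rewrite -in_set1 -zE inE.
by rewrite (mem p up) (mem w uw).
Qed.

Lemma pendent_adj_neq2 u p v : adj E u p -> degree E u = 1 -> v \in A ->
  v != u -> v != p -> 2 <= degree E p.
Proof.
move=> up du vA nvu nvp; have pA := adj_memr up.
have [|w [pw dw _]] := tm_parent tmE pA vA; first by rewrite eq_sym.
have duv := dist_pendent up du vA nvu.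
have nwu : w != u by apply/negP => /eqP e; rewrite e in dw; nat_lia.
rewrite /degree (cardsD1 u) (cardsD1 w) !inE adj_sym up nwu pw; nat_lia.
Qed.

(** A simple path never moves away from its end. If its first step [u], [x] did, the rest of the
    path, which is geodesic by induction, would approach [v] from [x] through [y]; then [u] and [y]
    would both be the parent of [x], contradicting simplicity. *)
Lemma path_dist u v p : u \in A -> v \in A -> path (adj E) u p ->
  uniq (u :: p) -> last u p = v -> size p = dist u v.
Proof.
have [n] := ubnP (size p); elim: n u p => // n IHn u [|x p] /=.
  by move=> _ uA _ _ _ <-; rewrite (tm_id tmE uA).
rewrite ltnS => ltpn uA vA /andP[ux xp] /andP[u_notin uniq_xp] lastv.
have xA := adj_memr ux.
rewrite (IHn x p ltpn xA vA xp uniq_xp lastv).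
have [dx|->//] := dist_adj vA ux.
case: p ltpn xp u_notin uniq_xp lastv => [|y p] /=.
  by move=> _ _ _ _ exv; move: dx; rewrite exv (tm_id tmE vA).
move=> ltpn /andP[xy yp] u_notin uniq_xp lastv.
have nuy : u != y by move: u_notin; rewrite !inE !negb_or => /and3P[].
have uniq_yp : uniq (y :: p) by case/andP: uniq_xp.
have dyv := IHn y p (ltnW ltpn) (adj_memr xy) vA yp uniq_yp lastv.
have xyp : path (adj E) x (y :: p) by rewrite /= xy.
have /= dxv := IHn x (y :: p) ltpn xA vA xyp uniq_xp lastv.
have xu : adj E x u by rewrite adj_sym.
by have /eqP := parent_uniq xA vA xu xy dx ltac:(nat_lia); rewrite (negPf nuy).
Qed.

(** The bound on the distances along the path is the invariant that keeps the path simple when a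
    farther vertex is prepended. *)
Lemma geodesic u v : u \in A -> v \in A ->
  exists p, [/\ path (adj E) u p, uniq (u :: p), last u p = v
              & all (fun z => dist z v <= dist u v) (u :: p)].
Proof.
have [n] := ubnP (dist u v); elim: n u => // n IHn u ltn uA vA.
have [->|nuv] := eqVneq u v; first by exists [::]; split; rewrite //= leqnn.
have [w [uw dw _]] := tm_parent tmE uA vA nuv.
have [|p [wp uniq_wp lastv /allP closer]] := IHn w _ (adj_memr uw) vA; first by nat_lia.
have far : u \notin w :: p.
  by apply/negP => u_in; have /= := closer u u_in; rewrite dw ltnn.
exists (w :: p); split=> //.
- by rewrite /= uw.
- by rewrite cons_uniq far.
apply/allP => z; rewrite inE => /predU1P[->|z_in]; first exact: leqnn.
by have /= := closer z z_in; nat_lia.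
Qed.

End Basics.
End TreeMetric.

(** * Comparison with connected acyclic graphs *)

Section Bridge.
Variable V : finType.
Implicit Types (A L X : {set V}) (E : {set {set V}}) (dist : V -> V -> nat).
Implicit Types (a b m u v w x y : V).

Definition simple_path E u v (p : seq V) : bool :=
  [&& path (adj E) u p, uniq (u :: p) & last u p == v].

Lemma simple_path_cons E u v w p : simple_path E u v (w :: p) =
  [&& adj E u w, u \notin w :: p & simple_path E w v p].
Proof.
rewrite /simple_path cons_uniq /=.
by case: (adj E u w); case: (u \notin _); rewrite /= ?andbF.
Qed.

Lemma tree_dist_path E u v p : simple_path E u v p ->
  (forall q, simple_path E u v q -> size q = size p) ->
  tree_dist E u v = size p.
Proof.
move=> p_uv sz; rewrite /tree_dist; set P := (fun n : nat => _).
have Psz n : P n -> n = size p.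
  by case/existsP=> t /sz; rewrite size_tuple.
have Pp : P (size p) by apply/existsP; exists (in_tuple p).
have lt_p : size p < #|V|.
  have /card_uniqP/= <- : uniq (u :: p) by case/and3P: p_uv.
  exact: max_card.
have hasP : has P (iota 0 #|V|).
  by apply/hasP; exists (size p); rewrite // mem_iota.
have := nth_find 0 hasP; rewrite nth_iota; first by rewrite add0n => /Psz.
by rewrite -[X in _ < X](size_iota 0) -has_find.
Qed.

Lemma tree_metric_dist A E dist u v : tree_metric A E dist ->
  u \in A -> v \in A -> tree_dist E u v = dist u v.
Proof.
move=> tmE uA vA; have [p [up uniq_p lastv _]] := geodesic tmE uA vA.
have sz q : simple_path E u v q -> size q = dist u v.
  by case/and3P=> uq uniq_q /eqP lq; apply: (path_dist tmE).
have p_uv : simple_path E u v p by rewrite /simple_path up uniq_p lastv /=.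
by rewrite -(sz p p_uv); apply: tree_dist_path => // q /sz ->; rewrite sz.
Qed.

Lemma tree_metric_is_tree E dist : tree_metric [set: V] E dist -> is_tree E.
Proof.
move=> tmE; split.
- by move=> e /(tm_edge tmE)/andP[_ /eqP].
- move=> u v; have [p [up _ lastv _]] := geodesic tmE (in_setT u) (in_setT v).
  by apply/connectP; exists p.
move=> [|z c] //= sz_c /andP[cyc_c uniq_c].
(* On a cycle, a vertex farthest from a fixed vertex has two cycle neighbours that are both closer,
   hence equal by uniqueness of the parent. *)
have [u u_c u_max] := arg_maxnP (fun t => dist t z) (mem_head z c).
have [i s rot_s] := rot_to u_c.
have := cyc_c; rewrite -(rot_cycle i) rot_s /=.
have := uniq_c; rewrite -(rot_uniq i) rot_s /= => /andP[u_s uniq_s].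
have mem_s t : t \in s -> t \in z :: c.
  by move=> t_s; rewrite -(mem_rot i) rot_s inE t_s orbT.
have sz_s : 1 < size s.
  by have := size_rot i (z :: c); rewrite rot_s /= in sz_c *; nat_lia.
case: s sz_s mem_s u_s uniq_s {rot_s} => [|x s] //= sz_s mem_s _ /andP[x_s _].
rewrite rcons_path => /and3P[ux _ /= lu].
set y := last x s in lu.
have y_s : y \in s by rewrite /y; case: (s) sz_s => //= t r _; apply: mem_last.
have dx := dist_adj tmE (in_setT z) ux.
rewrite adj_sym in lu; have dy := dist_adj tmE (in_setT z) lu.
have lex : dist x z <= dist u z by apply/u_max/mem_s/mem_head.
have ley : dist y z <= dist u z by apply/u_max/mem_s; rewrite inE y_s orbT.
have exy : x = y.
  by apply: (parent_uniq tmE (in_setT u) (in_setT z) ux lu); nat_lia.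
by rewrite exy y_s in x_s.
Qed.

(** * Unique simple paths in a connected acyclic graph *)

Section TreePaths.
Variable E : {set {set V}}.
Hypothesis treeE : is_tree E.

Lemma tree_adj_neq u v : adj E u v -> u != v.
Proof. by move=> /(tree_edges treeE)/eqP; rewrite cards2_eq2. Qed.

Lemma simple_path_uniq u v p q :
  simple_path E u v p -> simple_path E u v q -> p = q.
Proof.
elim: p u q => [|x p IHp] u [|y q] //=.
- case/and3P=> _ _ /eqP/= <- /and3P[_ /andP[u_yq _] /eqP/= lq].
  by rewrite -[in X in X \notin _]lq mem_last in u_yq.
- case/and3P=> _ /andP[u_xp _] /eqP/= lp /and3P[_ _ /eqP/= euv].
  by rewrite euv -[in X in X \notin _]lp mem_last in u_xp.
case/and3P=> /= /andP[ux xp] /andP[nup uniq_p] lp.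
case/and3P=> /= /andP[uy yq] /andP[nuq uniq_q] lq.
have [exy|nxy] := eqVneq x y.
  congr (_ :: _) => //; apply: (IHp x); first by apply/and3P; split.
  by rewrite exy; apply/and3P; split.
exfalso.
(* The graph with [u] deleted. Both tails survive in it and join [x] to [y]; a simple path between
   them there closes up through [u] into a cycle. *)
pose e := [rel s t | [&& adj E s t, s != u & t != u]].
have in_e z s : path (adj E) z s -> u \notin z :: s -> path e z s.
  elim: s z => [|t s IHs] z //= /andP[zt ts].
  rewrite !inE !negb_or => /and3P[nz nt ns].
  by rewrite zt eq_sym nz eq_sym nt /= IHs // inE negb_or nt ns.
have off_e z s : path e z s -> path (adj E) z s && (u \notin s).
  elim: s z => [|t s IHs] z //= /andP[/and3P[zt _ nt] /IHs/andP[ts us]].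
  by rewrite zt ts inE negb_or eq_sym nt us.
have e_sym : connect_sym e.
  by apply: sym_connect_sym => s t /=; rewrite adj_sym [(s != u) && _]andbC.
have cxv : connect e x v.
  by apply/connectP; exists p; rewrite ?(eqP lp) //; apply: in_e.
have cyv : connect e y v.
  by apply/connectP; exists q; rewrite ?(eqP lq) //; apply: in_e.
have : connect e x y by apply: connect_trans cxv _; rewrite e_sym.
case/connectP=> s0 /shortenP[s /off_e/andP[xs us] uniq_s _] ly.
have nux : u != x by apply: tree_adj_neq.
have sz_s : 0 < size s.
  by case: s ly {xs us uniq_s} => //= eyx; rewrite eyx eqxx in nxy.
apply: (tree_acyclic treeE (c := [:: u, x & s])) => //.
by rewrite /ucycle /= rcons_path ux xs -ly adj_sym uy inE negb_or nux us.
Qed.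

Lemma simple_path_exists u v : exists p, simple_path E u v p.
Proof.
have /connectP[p0 /shortenP[p up uniq_p _] ->] := tree_connected treeE u v.
by exists p; rewrite /simple_path up uniq_p /=.
Qed.

Lemma tree_dist_simple_path u v p :
  simple_path E u v p -> tree_dist E u v = size p.
Proof.
by move=> p_uv; apply: tree_dist_path => // q /(simple_path_uniq p_uv) ->.
Qed.

(** Either the simple path from [w] to [v] avoids [u], and prepending [u] gives the path from [u];
    or it meets [u], and uniqueness of paths forces [u] to be its second vertex. The second
    alternative keeps the path itself, so that the closer neighbour can be recognized as its first
    step. *)
Lemma tree_dist_adj u w v : adj E u w -> tree_dist E w v = (tree_dist E u v).+1 \/
   (exists p, simple_path E u v (w :: p)) /\ tree_dist E u v = (tree_dist E w v).+1.
Proof.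
move=> uw; have [p p_wv] := simple_path_exists w v.
have nuw := tree_adj_neq uw.
have /and3P[wp uniq_p lp] := p_wv.
have [u_p|nup] := boolP (u \in w :: p); last first.
  have p_uv : simple_path E u v (w :: p).
    by rewrite simple_path_cons uw nup.
  right; split; first by exists p.
  by rewrite (tree_dist_simple_path p_uv) (tree_dist_simple_path p_wv).
left; rewrite inE (negPf nuw) /= in u_p.
case/splitPr: u_p p_wv wp uniq_p lp => p1 p2 p_wv.
rewrite cat_path -cat_cons cat_uniq last_cat /= => /and3P[wp1 lu up2].
case/and3P=> uniq_p1 disj uniq_p2 lp.
have p_uv : simple_path E u v p2 by rewrite /simple_path up2 lp /= uniq_p2.
have p1u : simple_path E w u (rcons p1 u).
  apply/and3P; split; first by rewrite rcons_path wp1 lu.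
    by rewrite -rcons_cons rcons_uniq; case/norP: disj => -> _; apply: uniq_p1.
  by rewrite last_rcons.
have wu : simple_path E w u [:: u].
  by rewrite /simple_path /= adj_sym uw inE eq_sym nuw eqxx.
have /(congr1 size) := simple_path_uniq p1u wu.
rewrite size_rcons => -[/size0nil e]; rewrite e in p_wv.
by rewrite (tree_dist_simple_path p_uv) (tree_dist_simple_path p_wv).
Qed.

Lemma tree_distC u v : tree_dist E u v = tree_dist E v u.
Proof.
have [p p_uv] := simple_path_exists u v.
suff: simple_path E v u (rev (belast u p)).
  move/tree_dist_simple_path ->.
  by rewrite (tree_dist_simple_path p_uv) size_rev size_belast.
have /and3P[up uniq_p /eqP lp] := p_uv.
rewrite /simple_path -[in X in path _ X]lp rev_path.
rewrite (eq_path (e' := adj E)); last by move=> s t; rewrite /= adj_sym.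
rewrite up -lp -rev_rcons -lastI rev_uniq uniq_p /= {lp p_uv uniq_p up}.
by case: p => //= x p; rewrite rev_cons last_rcons.
Qed.

Lemma is_tree_metric : tree_metric [set: V] E (tree_dist E).
Proof.
split=> [e e_E|u _|u v _ _|u v _ _ nuv].
- by rewrite subsetT (tree_edges treeE e_E) eqxx.
- by rewrite (@tree_dist_simple_path _ _ [::]) // /simple_path /= eqxx.
- exact: tree_distC.
have [[|w p] p_uv] := simple_path_exists u v.
  by rewrite /simple_path /= (negPf nuv) in p_uv.
have uw : adj E u w by move: p_uv; rewrite simple_path_cons => /and3P[].
have w_head p' w' : simple_path E u v (w' :: p') -> w' = w.
  by move/(simple_path_uniq p_uv) => -[->].
exists w; split=> //.
  have p_wv : simple_path E w v p.
    by move: p_uv; rewrite simple_path_cons => /and3P[].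
  by rewrite (tree_dist_simple_path p_uv) (tree_dist_simple_path p_wv).
move=> w' uw' nw'; case: (tree_dist_adj v uw') => // -[[p' /w_head e]].
by rewrite e eqxx in nw'.
Qed.

End TreePaths.
End Bridge.

(** * Moving a branch *)

Section Branch.
Variable V : finType.
Implicit Types (A L X : {set V}) (E : {set {set V}}) (dist : V -> V -> nat).
Implicit Types (a b m u v w x y : V).

(** The side of [x] once the edge between [a] and [x] is cut, described by distances instead of
    connectivity. *)
Definition branch A dist a x : {set V} := [set v in A | dist x v < dist a v].

Definition move_branch E a b x := [set b; x] |: (E :\ [set a; x]).

Definition move_dist A dist a b x u v :=
  if u \in branch A dist a x
  then if v \in branch A dist a x then dist u v else dist u x + 1 + dist b v
  else if v \in branch A dist a x then dist v x + 1 + dist b u else dist u v.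

Variables (A : {set V}) (E : {set {set V}}) (dist : V -> V -> nat).
Hypothesis tmE : tree_metric A E dist.
Variables (a x : V).
Hypothesis ax : adj E a x.
Let aA : a \in A := adj_meml tmE ax.
Let xA : x \in A := adj_memr tmE ax.
Let X := branch A dist a x.

Lemma branch_distl v : v \in X -> dist a v = (dist x v).+1.
Proof. by rewrite inE => /andP[vA lt]; have := dist_adj tmE vA ax; nat_lia. Qed.

Lemma branch_distr v : v \in A -> v \notin X -> dist x v = (dist a v).+1.
Proof. by move=> vA; rewrite inE vA /=; have := dist_adj tmE vA ax; nat_lia. Qed.

Lemma branch_root : x \in X.
Proof.
by rewrite inE xA (tm_id tmE xA) (dist_gt0 tmE) // (adj_neq tmE ax).
Qed.

Lemma branch_base : a \notin X.
Proof. by rewrite inE (tm_id tmE aA) ltn0 andbF. Qed.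

Lemma branch_mem v : v \in X -> v \in A.
Proof. by rewrite inE => /andP[]. Qed.

(** The edge between [a] and [x] is a bridge: every path leaving the branch goes through [x] and
    then [a]. *)
Lemma branch_dist u v : u \in X -> v \in A -> v \notin X ->
  dist u v = dist u x + 1 + dist a v.
Proof.
have [n] := ubnP (dist u x); elim: n u => // n IHn u ltn uX vA vX.
have uA := branch_mem uX.
have [->|nux] := eqVneq u x.
  by rewrite (tm_id tmE xA) branch_distr //; nat_lia.
have [w [uw dw _]] := tm_parent tmE uA xA nux.
have wA := adj_memr tmE uw.
have wu : adj E w u by rewrite adj_sym.
have wX : w \in X.
  rewrite inE wA; have := branch_distl uX; have := dist_adj tmE aA uw.
  by rewrite !(tm_sym tmE aA) // !(tm_sym tmE xA) //; nat_lia.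
have dwv := IHn w ltac:(nat_lia) wX vA vX.
(* Were [u] closer to [v] than [w], it would be the parent of [w] toward [v]. But that parent is [a]
   when [w] is [x], and otherwise the next vertex [t] toward [x]; neither can be [u]. *)
case: (dist_adj tmE vA wu) => [|dwu]; first by nat_lia.
have [ewx|nwx] := eqVneq w x.
  have xa : adj E w a by rewrite ewx adj_sym.
  have eua : u = a.
    by apply: (parent_uniq tmE wA vA wu xa dwu); rewrite ewx branch_distr.
  by rewrite eua (negPf branch_base) in uX.
have [t [wt dt _]] := tm_parent tmE wA xA nwx.
have tX : t \in X.
  rewrite inE (adj_memr tmE wt); have := branch_distl wX; have := dist_adj tmE aA wt.
  have tA := adj_memr tmE wt.
  by rewrite !(tm_sym tmE aA) // !(tm_sym tmE xA) //; nat_lia.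
have dtv := IHn t ltac:(nat_lia) tX vA vX.
have := parent_uniq tmE wA vA wu wt dwu ltac:(nat_lia) => eut.
by rewrite eut in dw; nat_lia.
Qed.

Lemma branch_cut u v : u \in X -> v \notin X -> adj E u v -> u = x /\ v = a.
Proof.
move=> uX vX uv; have uA := adj_meml tmE uv; have vA := adj_memr tmE uv.
move: uv; rewrite (adj_dist1 tmE uA vA) branch_dist // => /eqP d1.
split; apply/eqP/contraT => ne; first by have := dist_gt0 tmE uA xA ne; nat_lia.
by rewrite eq_sym in ne; have := dist_gt0 tmE aA vA ne; nat_lia.
Qed.

(** A vertex of the branch farthest from [a] works: a second neighbour would be still farther from
    [a], and it cannot be outside the branch, where the only exit is [a] itself. *)
Lemma branch_pendent : exists2 u, u \in X & degree E u = 1.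
Proof.
have [u uX u_max] := arg_maxnP (dist a) branch_root.
exists u => //; have uA := branch_mem uX.
have nua : u != a by apply: contraTneq uX => ->; apply: branch_base.
have [w [uw dw others]] := tm_parent tmE uA aA nua.
apply/eqP/cards1P; exists w; apply/setP => t; rewrite !inE.
apply/idP/eqP => [ut|->//]; apply/eqP/contraT => ntw.
have dt := others t ut ntw; have tA := adj_memr tmE ut.
have tX : t \in X.
  apply/contraT => ntX; have [_ eta] := branch_cut uX ntX ut.
  by rewrite eta (tm_id tmE aA) in dt.
by have := u_max t tX; rewrite /= !(tm_sym tmE aA) //; nat_lia.
Qed.

Variable b : V.
Hypotheses (bA : b \in A) (bX : b \notin X).

Let E' := move_branch E a b x.
Let dist' := move_dist A dist a b x.

Lemma adj_move u v : adj E' u v =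
  ([set u; v] == [set b; x]) || ([set u; v] != [set a; x]) && adj E u v.
Proof. by rewrite /adj !inE. Qed.

Lemma adj_move_same u v : (u \in X) = (v \in X) -> adj E' u v = adj E u v.
Proof.
have xX := branch_root => same.
have crossing t : t \notin X -> ([set u; v] == [set t; x]) = false.
  move=> tX; apply/negP => /eqP/setP e.
  have := e x; have := e t; rewrite !inE !eqxx orbT /=.
  case/orP=> /eqP et; case/orP=> /eqP ex.
  - by rewrite et -ex xX in tX.
  - by move: same; rewrite -et -ex xX (negPf tX).
  - by move: same; rewrite -et -ex xX (negPf tX).
  - by rewrite et -ex xX in tX.
by rewrite adj_move !crossing ?branch_base.
Qed.

Lemma adj_move_cross u v : u \in X -> v \notin X ->
  adj E' u v = (u == x) && (v == b).
Proof.
have xX := branch_root => uX vX; rewrite adj_move.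
have nux t : t \notin X -> (u == t) = false by move=> tX; apply: contraNF tX => /eqP<-.
have nvx : (v == x) = false by apply: contraNF vX => /eqP->.
have pairE t : t \notin X -> ([set u; v] == [set t; x]) = (u == x) && (v == t).
  move=> tX; apply/eqP/andP => [/setP e|[/eqP-> /eqP->]]; last by rewrite setUC.
  have := e u; have := e v; rewrite !inE !eqxx orbT /= nux // nvx orbF /=.
  by move=> <- <-.
rewrite !pairE ?branch_base //.
case: (boolP (adj E u v)) => [/(branch_cut uX vX)[-> ->]|_]; last by rewrite andbF orbF.
by rewrite !eqxx /= orbF.
Qed.

(** Within one side the parents do not change. From one side to the other, the parent becomes the
    old parent toward [x] or toward [b], the ends of the new edge, except at those ends, which are
    parents of each other. *)
Lemma move_tree_metric : tree_metric A E' dist'.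
Proof.
have xX := branch_root.
have nbx : b != x by apply: contraNneq bX => ->.
split.
- move=> e; rewrite !inE => /predU1P[->|/andP[_ /(tm_edge tmE)//]].
  by rewrite cards2_eq2 nbx subUset !sub1set bA xA.
- by move=> u uA; rewrite /dist' /move_dist ; case: (u \in _); rewrite (tm_id tmE).
- move=> u v uA vA; rewrite /dist' /move_dist.
  by case: ifP => _; case: ifP => _ //; apply: (tm_sym tmE).
move=> u v uA vA nuv; rewrite /dist' /move_dist -/X.
case: (boolP (u \in X)) => uX; case: (boolP (v \in X)) => vX.
- have [w [uw dw others]] := tm_parent tmE uA vA nuv.
  have wX : w \in X.
    apply/contraT => wX; have [eux ewa] := branch_cut uX wX uw.
    by have := branch_distl vX; rewrite -eux -ewa; nat_lia.
  exists w; rewrite adj_move_same ?uX ?wX //; split=> // t ut ntw.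
  case: (boolP (t \in X)) => tX; last first.
    move: ut; rewrite adj_move_cross // => /andP[/eqP -> /eqP ->].
    by rewrite (tm_id tmE bA) (tm_sym tmE xA vA); nat_lia.
  by apply: others; rewrite // -adj_move_same ?uX ?tX.
- have [eux|nux] := eqVneq u x.
    exists b; rewrite adj_move_cross // eux !eqxx (negPf bX); split=> //.
      by rewrite (tm_id tmE xA).
    move=> t xt ntb; case: (boolP (t \in X)) => tX; last first.
      by move: xt; rewrite adj_move_cross // (negPf ntb) andbF.
    have {}xt : adj E x t by rewrite -adj_move_same ?xX ?tX.
    move: xt; rewrite (adj_dist1 tmE) // ?(branch_mem tX) // => /eqP.
    by rewrite (tm_sym tmE xA) ?(branch_mem tX) // (tm_id tmE xA) => ->.
  have [w [uw dw others]] := tm_parent tmE uA xA nux.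
  have nbr t : adj E u t -> t \in X.
    move=> ut; apply/contraT => tX; have [eux _] := branch_cut uX tX ut.
    by rewrite eux eqxx in nux.
  have wX := nbr w uw.
  exists w; rewrite adj_move_same ?uX ?wX //; split=> //; first by nat_lia.
  move=> t ut ntw; case: (boolP (t \in X)) => tX; last first.
    by move: ut; rewrite adj_move_cross // (negPf nux).
  by rewrite (others t) // -adj_move_same ?uX ?tX.
- have [eub|nub] := eqVneq u b.
    exists x; rewrite adj_sym adj_move_cross // eub !eqxx xX; split=> //.
      by rewrite (tm_id tmE bA) (tm_sym tmE vA xA); nat_lia.
    move=> t bt ntx; case: (boolP (t \in X)) => tX.
      by move: bt; rewrite adj_sym adj_move_cross // (negPf ntx).
    have {}bt : adj E b t by rewrite -adj_move_same ?(negPf bX) ?(negPf tX).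
    have tA := adj_memr tmE bt.
    move: bt; rewrite (adj_dist1 tmE) // => /eqP.
    by rewrite (tm_id tmE bA) => ->; nat_lia.
  have [w [uw dw others]] := tm_parent tmE uA bA nub.
  have wX : w \notin X.
    apply/negP => wX; rewrite adj_sym in uw; have [ewx eua] := branch_cut wX uX uw.
    by have := branch_distr bA bX; rewrite -eua -ewx; nat_lia.
  have symb t : t \in A -> dist b t = dist t b by move=> tA; apply: (tm_sym tmE).
  exists w; rewrite adj_move_same ?(negPf uX) ?(negPf wX) //; split=> //.
    by rewrite !symb ?(adj_memr tmE uw) //; nat_lia.
  move=> t ut ntw; case: (boolP (t \in X)) => tX.
    by move: ut; rewrite adj_sym adj_move_cross // (negPf nub) andbF.
  have {}ut : adj E u t by rewrite -adj_move_same ?(negPf uX) ?(negPf tX).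
  by rewrite !symb ?(adj_memr tmE ut) // (others t) //; nat_lia.
have [w [uw dw others]] := tm_parent tmE uA vA nuv.
have wX : w \notin X.
  apply/negP => wX; rewrite adj_sym in uw; have [ewx eua] := branch_cut wX uX uw.
  by have := branch_distr vA vX; rewrite -eua -ewx; nat_lia.
exists w; rewrite adj_move_same ?(negPf uX) ?(negPf wX) //; split=> // t ut ntw.
case: (boolP (t \in X)) => tX.
  move: ut; rewrite adj_sym adj_move_cross // => /andP[/eqP -> /eqP ->].
  by rewrite (tm_id tmE xA); nat_lia.
by apply: others; rewrite // -adj_move_same ?(negPf uX) ?(negPf tX).
Qed.

Hypothesis nab : a != b.

Lemma degree_move_from : degree E a = (degree E' a).+1.
Proof.
have aX := branch_base; have xX := branch_root.
rewrite /degree (cardsD1 x) inE ax add1n; congr (#|pred_of_set _|.+1).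
apply/setP => t; rewrite !inE; have [->|ntx] /= := eqVneq t x.
  by rewrite adj_sym adj_move_cross // eqxx (negPf nab).
case: (boolP (t \in X)) => tX; last by rewrite adj_move_same // (negPf aX) (negPf tX).
rewrite [RHS]adj_sym adj_move_cross // (negPf ntx) /=.
by apply/negP; rewrite adj_sym => /(branch_cut tX aX)[/eqP]; rewrite (negPf ntx).
Qed.

Lemma degree_move_to : degree E' b = (degree E b).+1.
Proof.
have xX := branch_root.
rewrite /degree (cardsD1 x) inE adj_sym adj_move_cross // !eqxx add1n.
congr (#|pred_of_set _|.+1); apply/setP => t; rewrite !inE.
have [->|ntx] /= := eqVneq t x.
  apply/esym/negP; rewrite adj_sym => /(branch_cut xX bX)[_ /eqP].
  by rewrite eq_sym (negPf nab).
case: (boolP (t \in X)) => tX; last by rewrite adj_move_same // (negPf bX) (negPf tX).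
rewrite adj_sym adj_move_cross // (negPf ntx) /=.
by apply/esym/negP; rewrite adj_sym => /(branch_cut tX bX)[/eqP]; rewrite (negPf ntx).
Qed.

Lemma degree_move_other u : u != a -> u != b -> degree E' u = degree E u.
Proof.
have aX := branch_base; have xX := branch_root => nua nub.
have [->|nux] := eqVneq u x; last first.
  congr #|pred_of_set _|; apply/setP => t; rewrite !inE.
  case: (boolP (u \in X)) => uX; case: (boolP (t \in X)) => tX.
  - by rewrite adj_move_same ?uX ?tX.
  - rewrite adj_move_cross // (negPf nux); apply/esym/negP.
    by move/(branch_cut uX tX)=> [/eqP]; rewrite (negPf nux).
  - rewrite adj_sym adj_move_cross // (negPf nub) andbF; apply/esym/negP.
    by rewrite adj_sym => /(branch_cut tX uX)[_ /eqP]; rewrite (negPf nua).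
  - by rewrite adj_move_same ?(negPf uX) ?(negPf tX).
(* The root [x] of the branch trades its neighbour [a] for [b]. *)
rewrite /degree (cardsD1 b) [RHS](cardsD1 a) !inE adj_move_cross // !eqxx.
have -> : adj E x a by rewrite adj_sym.
rewrite !add1n.
congr (#|pred_of_set _|.+1); apply/setP => t; rewrite !inE.
case: (boolP (t \in X)) => tX.
  rewrite adj_move_same ?xX ?tX //.
  have -> : t != b by apply: contraNneq bX => <-.
  by have -> : t != a by apply: contraNneq aX => <-.
rewrite adj_move_cross // eqxx /=; case: eqP => //= [->|_].
  rewrite eq_sym nab /=; apply/esym/negP => /(branch_cut xX bX)[_ /eqP].
  by rewrite eq_sym (negPf nab).
apply/esym/negP => /andP[nta /(branch_cut xX tX)[_ /eqP]].
by rewrite (negPf nta).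
Qed.

End Branch.

(** * Relabelling, adding and removing stars *)

Section Relabel.
Variable V : finType.
Implicit Types (A L X : {set V}) (E : {set {set V}}) (dist : V -> V -> nat).
Implicit Types (a b m u v w x y : V).

Definition relabel a b E : {set {set V}} := [set tperm a b @: e | e : {set V} in E].

Lemma adj_relabel a b E u v :
  adj (relabel a b E) u v = adj E (tperm a b u) (tperm a b v).
Proof.
rewrite /adj -[in LHS](tpermK a b u) -[in LHS](tpermK a b v).
rewrite -imset_set1 -(imset_set1 _ (tperm a b v)) -imsetU.
by rewrite mem_imset //; apply/imset_inj/perm_inj.
Qed.

Lemma degree_relabel a b E u : degree (relabel a b E) u = degree E (tperm a b u).
Proof.
rewrite /degree -(card_preimset _ (@perm_inj _ (tperm a b))).
by congr #|pred_of_set _|; apply/setP => v; rewrite !inE adj_relabel tpermK.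
Qed.

Lemma tperm_mem A a b u : a \in A -> b \in A -> (tperm a b u \in A) = (u \in A).
Proof. by move=> aA bA; case: tpermP => [->|->|//]; rewrite aA bA. Qed.

Lemma relabel_tree_metric A E dist a b : tree_metric A E dist ->
  a \in A -> b \in A ->
  tree_metric A (relabel a b E) (fun u v => dist (tperm a b u) (tperm a b v)).
Proof.
move=> tmE aA bA; have sA u := tperm_mem u aA bA.
split=> [_ /imsetP[e eE ->]|u uA|u v uA vA|u v uA vA nuv].
- have /andP[/subsetP subA /eqP cards] := tm_edge tmE eE.
  rewrite card_imset ?cards ?andbT; last exact: perm_inj.
  by apply/subsetP => _ /imsetP[u /subA uA ->]; rewrite sA.
- by rewrite (tm_id tmE) ?sA.
- by apply: (tm_sym tmE); rewrite sA.
have [|||w [uw dw others]] := tm_parent tmE (u := tperm a b u) (v := tperm a b v).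
- by rewrite sA.
- by rewrite sA.
- by rewrite (inj_eq perm_inj).
exists (tperm a b w); rewrite adj_relabel tpermK; split=> // t ut ntw.
apply: others; first by rewrite -adj_relabel.
by apply: contra_neq ntw => <-; rewrite tpermK.
Qed.

End Relabel.

Section Star.
Variable V : finType.
Implicit Types (A L X : {set V}) (E : {set {set V}}) (dist : V -> V -> nat).
Implicit Types (a b m u v w x y : V).

Lemma set2_eq2 u v x y :
  ([set u; v] == [set x; y]) = (u == x) && (v == y) || (u == y) && (v == x).
Proof.
apply/eqP/orP => [/setP e|[] /andP[/eqP-> /eqP->] //]; last by rewrite setUC.
have := e u; have := e v; have := e x; have := e y.
rewrite !inE !eqxx !orbT /= (eq_sym x u) (eq_sym x v) (eq_sym y u) (eq_sym y v).
by case: (u == x); case: (u == y); case: (v == x); case: (v == y); auto.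
Qed.

Lemma star_edges_mem m L u v : ([set u; v] \in star_edges m L) =
  (u == m) && (v \in L) || (v == m) && (u \in L).
Proof.
apply/imsetP/orP => [[l lL /eqP]|[] /andP[/eqP -> lL]].
- by rewrite set2_eq2 => /orP[] /andP[/eqP-> /eqP->]; rewrite eqxx lL; [left | right].
- by exists v.
- by exists u; rewrite // setUC.
Qed.

Lemma star_edges_sub m L E : (forall l, l \in L -> adj E m l) ->
  star_edges m L \subset E.
Proof. by move=> ml; apply/subsetP => _ /imsetP[l /ml lE ->]. Qed.

(** A pendent vertex is never the next step toward a third vertex, so the remaining vertices keep
    their parents and the same [dist] still serves. *)
Lemma remove_star A E dist m L : tree_metric A E dist ->
  (forall l, l \in L -> adj E m l) -> (forall l, l \in L -> degree E l = 1) ->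
  tree_metric (A :\: L) (E :\: star_edges m L) dist.
Proof.
move=> tmE mL dL.
have nbr l t : l \in L -> adj E l t -> t = m.
  move=> lL lt; have /eqP/cards1P[z zE] := dL l lL.
  have lm : adj E l m by rewrite adj_sym mL.
  have : t \in [set z] by rewrite -zE inE.
  have : m \in [set z] by rewrite -zE inE.
  by rewrite !inE => /eqP -> /eqP ->.
have mL' : m \notin L by apply/negP => /mL/(adj_neq tmE); rewrite eqxx.
have adjD u v : adj (E :\: star_edges m L) u v =
    [&& adj E u v, u \notin L & v \notin L].
  rewrite {1}/adj inE star_edges_mem andbC -/(adj E u v).
  case: (boolP (adj E u v)) => //= uv.
  case: (boolP (u \in L)) => uL /=; case: (boolP (v \in L)) => vL /=.
  - by have := nbr u v uL uv => evm; rewrite evm (negPf mL') in vL.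
  - by rewrite (nbr u v uL uv) eqxx /= orbT.
  - by rewrite adj_sym in uv; rewrite (nbr v u vL uv) eqxx.
  - by rewrite !andbF.
split=> [e|u|u v|u v].
- rewrite inE => /andP[eS eE].
  have /andP[eA /cards2P[x [y [nxy exy]]]] := tm_edge tmE eE.
  rewrite exy cards2_eq2 nxy andbT; subst e.
  have : adj (E :\: star_edges m L) x y by rewrite /adj inE eS.
  rewrite adjD subUset !sub1set !inE => /and3P[xy -> ->].
  by rewrite (adj_meml tmE xy) (adj_memr tmE xy).
- by rewrite inE => /andP[_]; apply: (tm_id tmE).
- by rewrite !inE => /andP[_ uA] /andP[_ vA]; apply: (tm_sym tmE).
rewrite !inE => /andP[uL uA] /andP[vL vA] nuv.
have [w [uw dw others]] := tm_parent tmE uA vA nuv.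
have wL : w \notin L.
  apply/negP => wL; have nvw : v != w by apply: contraNneq vL => ->.
  rewrite adj_sym in uw.
  by have := dist_pendent tmE uw (dL w wL) vA nvw; nat_lia.
exists w; rewrite adjD uw uL wL; split=> // t; rewrite adjD => /and3P[ut _ _].
exact: others.
Qed.

Definition shrink m L u := if u \in L then m else u.

(** Each endpoint that is a leaf costs one edge down to the center. The diagonal is separate because
    the formula would give 2 from a leaf to itself. *)
Definition star_dist dist m L u v : nat :=
  if u == v then 0 else (u \in L) + (v \in L) + dist (shrink m L u) (shrink m L v).

Section AddStar.
Variables (A L : {set V}) (E : {set {set V}}) (dist : V -> V -> nat) (m : V).
Hypotheses (tmE : tree_metric (A :\: L) E dist) (LA : L \subset A).
Hypothesis mAL : m \in A :\: L.

Let mL : m \notin L. Proof. by move: mAL; rewrite inE => /andP[]. Qed.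

Lemma adj_add_star u v : adj (star_edges m L :|: E) u v =
  [|| (u == m) && (v \in L), (v == m) && (u \in L) | adj E u v].
Proof. by rewrite /adj inE star_edges_mem orbA. Qed.

Lemma adj_add_starL l v : l \in L -> adj (star_edges m L :|: E) l v = (v == m).
Proof.
move=> lL; rewrite adj_add_star lL andbT.
have -> : (l == m) = false by apply: contraTF lL => /eqP->.
have -> : adj E l v = false.
  by apply/negP => /(adj_meml tmE); rewrite inE lL.
by rewrite orbF.
Qed.

Lemma adj_add_star_nL u v : u \notin L -> v \notin L ->
  adj (star_edges m L :|: E) u v = adj E u v.
Proof.
by move=> uL vL; rewrite adj_add_star (negPf uL) (negPf vL) !andbF.
Qed.

Lemma shrink_mem u : u \in A -> shrink m L u \in A :\: L.
Proof. by move=> uA; rewrite /shrink; case: ifPn => // uL; rewrite inE uL. Qed.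

Lemma add_star : tree_metric A (star_edges m L :|: E) (star_dist dist m L).
Proof.
have id_m := tm_id tmE mAL.
have mA : m \in A by move: mAL; rewrite inE => /andP[].
split.
- move=> e; rewrite inE => /orP[/imsetP[l lL ->]|/(tm_edge tmE)/andP[eA ->]].
    have nml : m != l by apply: contraNneq mL => ->.
    by rewrite cards2_eq2 nml subUset !sub1set mA (subsetP LA).
  by rewrite (subset_trans eA) // subsetDl.
- by move=> u _; rewrite /star_dist eqxx.
- move=> u v uA vA; rewrite /star_dist eq_sym; case: eqP => // _.
  by rewrite [(u \in L) + _]addnC (tm_sym tmE) ?shrink_mem.
move=> u v uA vA nuv; have svA := shrink_mem vA.
case: (boolP (u \in L)) => uL.
  exists m; rewrite adj_add_starL // eqxx; split=> //; last first.
    by move=> t; rewrite adj_add_starL // => /eqP->; rewrite eqxx.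
  rewrite {1}/star_dist (negPf nuv) uL {1}/shrink uL /star_dist (negPf mL).
  rewrite {2}/shrink (negPf mL).
  case: eqVneq => [<-|_]; last by nat_lia.
  by rewrite /shrink (negPf mL) id_m.
have usE : star_dist dist m L u v = (v \in L) + dist u (shrink m L v).
  by rewrite /star_dist (negPf nuv) (negPf uL) {1}/shrink (negPf uL).
have uAL : u \in A :\: L by rewrite inE uL.
have leafE t : t \in L -> t != v ->
    star_dist dist m L t v = (1 + (v \in L) + dist m (shrink m L v)).
  by move=> tL ntv; rewrite /star_dist (negPf ntv) tL {1}/shrink tL.
have nLE t : t \notin L -> t != v ->
    star_dist dist m L t v = (v \in L) + dist t (shrink m L v).
  by move=> tL ntv; rewrite /star_dist (negPf ntv) (negPf tL) {1}/shrink (negPf tL).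
have adj_uL t : t \in L -> adj (star_edges m L :|: E) u t = (u == m).
  by move=> tL; rewrite adj_sym adj_add_starL.
(* When [u] projects to the same vertex as [v], it is the center and [v] one of its leaves: the
   parent is [v] itself. Otherwise the parent is the one in the collapsed tree. *)
have [eus|nus] := eqVneq u (shrink m L v).
  have vL : v \in L.
    by apply: contraNT nuv => vL; rewrite eus /shrink (negPf vL).
  have eum : u = m by rewrite eus /shrink vL.
  have sv : shrink m L v = m by rewrite /shrink vL.
  rewrite vL sv eum id_m in usE.
  exists v; rewrite adj_uL // eum eqxx usE; split=> // [|t mt ntv].
    by rewrite /star_dist eqxx.
  case: (boolP (t \in L)) => tL; first by rewrite leafE // vL sv id_m.
  move: mt; rewrite adj_add_star_nL // => mt; have tA := adj_memr tmE mt.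
  rewrite nLE // vL sv (tm_sym tmE) //.
  by move: mt; rewrite (adj_dist1 tmE) // => /eqP->.
have [w [uw dw others]] := tm_parent tmE uAL svA nus.
have wL : w \notin L by move: (adj_memr tmE uw); rewrite inE => /andP[].
exists w; rewrite adj_add_star_nL //; split=> //.
  rewrite usE dw; case: (eqVneq w v) => [ewv|nwv]; last by rewrite nLE // addnS.
  rewrite /star_dist ewv eqxx /shrink -ewv (negPf wL) (tm_id tmE) //.
  exact: (adj_memr tmE uw).
move=> t ut ntw; case: (boolP (t \in L)) => tL.
  move: ut; rewrite adj_uL // => /eqP eum.
  have [etv|ntv] := eqVneq t v; last by rewrite leafE // usE eum; nat_lia.
  by move: nus; rewrite -etv /shrink tL eum eqxx.
rewrite adj_add_star_nL // in ut.
have dt := others t ut ntw.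
have [etv|ntv] := eqVneq t v; last by rewrite nLE // dt usE addnS.
move: dt; rewrite -etv /shrink (negPf tL) (tm_id tmE) //; exact: (adj_memr tmE ut).
Qed.

Lemma degree_add_star_leaf l : l \in L -> degree (star_edges m L :|: E) l = 1.
Proof.
move=> lL; apply/eqP/cards1P; exists m; apply/setP => t.
by rewrite !inE adj_add_starL.
Qed.

Lemma degree_add_star_center :
  degree (star_edges m L :|: E) m = #|L| + degree E m.
Proof.
rewrite /degree -cardsUI [X in _ = _ + X]eq_card0 ?addn0.
  congr #|pred_of_set _|; apply/setP => t.
  by rewrite !inE adj_add_star eqxx (negPf mL) andbF.
move=> t; rewrite !inE; apply/negP => /andP[tL /(adj_memr tmE)].
by rewrite inE tL.
Qed.

Lemma degree_add_star_other v : v \notin L -> v != m ->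
  degree (star_edges m L :|: E) v = degree E v.
Proof.
move=> vL nvm; congr #|pred_of_set _|; apply/setP => t.
by rewrite !inE adj_add_star (negPf vL) (negPf nvm) andbF.
Qed.

End AddStar.

Lemma singleton_tree_metric m : tree_metric [set m] set0 (fun _ _ => 0).
Proof.
split=> // [e|u v]; first by rewrite inE.
by move=> /set1P-> /set1P->; rewrite eqxx.
Qed.

End Star.

Local Open Scope ring_scope.

(** * Cost of the exchanges *)

Section Cost.
Variables (R : realFieldType) (V : finType).
Implicit Types (A L X : {set V}) (E : {set {set V}}) (dist : V -> V -> nat).
Implicit Types (a b m u v w x y : V) (mu : V -> R).

Definition dist_cost A mu dist : R :=
  \sum_(u in A) \sum_(v in A) mu u * mu v * (dist u v)%:R.

Definition transmission A mu dist a : R := \sum_(v in A) mu v * (dist a v)%:R.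

Lemma eq_dist_cost A mu dist dist' :
  (forall u v, u \in A -> v \in A -> dist u v = dist' u v) ->
  dist_cost A mu dist = dist_cost A mu dist'.
Proof. by move=> e; apply: eq_bigr => u uA; apply: eq_bigr => v vA; rewrite e. Qed.

Lemma dist_cost_relabel A mu dist a b : a \in A -> b \in A ->
  dist_cost A mu (fun u v => dist (tperm a b u) (tperm a b v)) =
  dist_cost A (mu \o tperm a b) dist.
Proof.
move=> aA bA; rewrite /dist_cost (reindex_inj (@perm_inj _ (tperm a b))) /=.
apply: eq_big => [u|u uA]; first by rewrite tperm_mem.
rewrite (reindex_inj (@perm_inj _ (tperm a b))) /=.
by apply: eq_big => [v|v vA]; rewrite ?tperm_mem ?tpermK.
Qed.

Lemma sum_point A (f : V -> R) a : a \in A ->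
  \sum_(u in A) (u == a)%:R * f u = f a.
Proof.
move=> aA; rewrite (bigD1 a) //= eqxx mul1r big1 ?addr0 // => u /andP[_ /negPf->].
by rewrite mul0r.
Qed.

(** The cost is a quadratic form in the weights, and the swap adds [w] at [b] and removes it at [a].
    The linear term gives the difference of transmissions, the quadratic one the distance; the
    factor 2 comes from summing over ordered pairs. *)
Lemma dist_cost_tperm A E mu dist a b : tree_metric A E dist ->
  a \in A -> b \in A -> a != b ->
  dist_cost A (mu \o tperm a b) dist = dist_cost A mu dist +
   2 * ((mu a - mu b) * (transmission A mu dist b - transmission A mu dist a)
        - (mu a - mu b) ^+ 2 * (dist a b)%:R).
Proof.
move=> tmE aA bA nab; set w := mu a - mu b.
have muE u : mu (tperm a b u) = mu u + w * ((u == b)%:R - (u == a)%:R).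
  rewrite /w; case: tpermP => [->|->|/eqP/negPf-> /eqP/negPf->] /=; last by ring.
    by rewrite eqxx (negPf nab) /=; ring.
  by rewrite eqxx eq_sym (negPf nab) /=; ring.
have diffE (f : V -> R) :
    \sum_(u in A) ((u == b)%:R - (u == a)%:R) * f u = f b - f a.
  rewrite -(sum_point f aA) -(sum_point f bA) -sumrB.
  by apply: eq_bigr => u _; rewrite mulrBl.
(* The transmission of [u] for the swapped weights. *)
pose g u := transmission A mu dist u + w * ((dist u b)%:R - (dist u a)%:R).
have innerE u : \sum_(v in A) mu (tperm a b v) * (dist u v)%:R = g u.
  rewrite /g -(diffE (fun v => (dist u v)%:R)) mulr_sumr -big_split /=.
  by apply: eq_bigr => v _; rewrite muE; ring.
transitivity (\sum_(u in A) mu (tperm a b u) * g u).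
  apply: eq_bigr => u _; rewrite -innerE mulr_sumr; apply: eq_bigr => v _.
  by rewrite /= mulrA.
transitivity (\sum_(u in A) mu u * g u + w * (g b - g a)).
  rewrite -diffE mulr_sumr -big_split /=.
  by apply: eq_bigr => u _; rewrite muE; ring.
have -> : \sum_(u in A) mu u * g u = dist_cost A mu dist
    + w * (transmission A mu dist b - transmission A mu dist a).
  rewrite /dist_cost /transmission -sumrB mulr_sumr -big_split /=.
  apply: eq_bigr => u uA; rewrite /g mulrDr !(tm_sym tmE uA) //.
  congr (_ + _); last by ring.
  by rewrite mulr_sumr; apply: eq_bigr => v _; rewrite mulrA.
rewrite /g !(tm_id tmE) // (tm_sym tmE bA aA); ring.
Qed.

Section Move.
Variables (A : {set V}) (E : {set {set V}}) (dist : V -> V -> nat) (mu : V -> R).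
Hypothesis tmE : tree_metric A E dist.
Variables (a x b : V).
Hypotheses (ax : adj E a x) (bA : b \in A) (bX : b \notin branch A dist a x).
Let aA : a \in A := adj_meml tmE ax.
Let X := branch A dist a x.

Lemma dist_cost_move :
  let g := \sum_(v in X) mu v in
  dist_cost A mu (move_dist A dist a b x) = dist_cost A mu dist +
  2 * (g * (transmission A mu dist b - transmission A mu dist a
            - g * (dist a b)%:R)).
Proof.
move=> g.
have XA v : v \in X -> v \in A by apply: branch_mem.
pose h v : R := (dist b v)%:R - (dist a v)%:R.
pose inX v : R := (v \in X)%:R.
have gE : g = \sum_(v in A) inX v * mu v.
  rewrite /g (big_mkcond (mem X)) [RHS]big_mkcond; apply: eq_bigr => v _ /=.
  rewrite /inX; case: (boolP (v \in X)) => [/XA->|_]; rewrite ?mul1r //.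
  by case: ifP => _; rewrite ?mul0r.
(* Only pairs split by the branch change distance, so the change is [g] times [H] for each order. On
   the branch, [h] is constantly the distance from [a] to [b], whence the correction by [g] times
   that distance. *)
pose H := \sum_(v in A) (1 - inX v) * mu v * h v.
have HE : transmission A mu dist b - transmission A mu dist a
    - g * (dist a b)%:R = H.
  rewrite gE /transmission /H mulr_suml -sumrB -sumrB; apply: eq_bigr => v vA.
  rewrite /h /inX; case: (boolP (v \in X)) => vX /=; last by ring.
  rewrite (tm_sym tmE bA vA) (branch_dist tmE ax vX bA bX) (tm_sym tmE aA vA).
  rewrite (branch_dist tmE ax vX aA (branch_base tmE ax)) (tm_id tmE aA).
  by rewrite !natrD; ring.
rewrite HE -[dist_cost A mu _](subrK (dist_cost A mu dist)) addrC; congr (_ + _).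
rewrite /dist_cost -sumrB.
under eq_bigr do rewrite -sumrB.
have prodE (f1 f2 : V -> R) : (\sum_(u in A) f1 u) * (\sum_(v in A) f2 v) =
    \sum_(u in A) \sum_(v in A) f1 u * f2 v.
  by rewrite mulr_suml; apply: eq_bigr => u _; rewrite mulr_sumr.
rewrite mulr_natl mulr2n gE {1}/H {2}[_ * H]mulrC /H !prodE -big_split /=.
apply: eq_bigr => u uA; rewrite -big_split /=; apply: eq_bigr => v vA.
rewrite /move_dist -/X /inX /h.
case: (boolP (u \in X)) => uX; case: (boolP (v \in X)) => vX /=; try by ring.
  by rewrite (branch_dist tmE ax uX vA vX) !natrD; ring.
rewrite (tm_sym tmE uA vA) (branch_dist tmE ax vX uA uX) !natrD; ring.
Qed.

Lemma move_dist_from v : v \in A ->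
  (dist a v <= move_dist A dist a b x a v)%N.
Proof.
move=> vA; rewrite /move_dist (negPf (branch_base tmE ax)).
case: ifP => vX //; rewrite (tm_sym tmE aA vA).
rewrite (branch_dist tmE ax vX aA (branch_base tmE ax)) (tm_id tmE aA); nat_lia.
Qed.

Lemma move_dist_to v : v \in A ->
  (move_dist A dist a b x b v <= dist b v)%N.
Proof.
move=> vA; rewrite /move_dist (negPf bX).
case: ifP => vX //; rewrite (tm_sym tmE bA vA).
rewrite (branch_dist tmE ax vX bA bX) (tm_id tmE bA); nat_lia.
Qed.

End Move.

(** Branches go from [a] to [b] one at a time. Each move can only raise the transmission of [a] and
    lower that of [b], so the comparison persists; each strictly pays off because a branch contains
    a pendent vertex, of positive weight. The degrees of [a] and [b] vary, hence their exclusion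
    from the positivity hypothesis. *)
Lemma move_branches A E mu dist a b n :
    tree_metric A E dist -> a \in A -> b \in A -> a != b ->
    (forall v, v \in A -> 0 <= mu v) ->
    (forall v, v \in A -> v != a -> v != b -> degree E v = 1%N -> 0 < mu v) ->
    transmission A mu dist b <= transmission A mu dist a ->
    (n < degree E a)%N ->
  exists E' dist', [/\ tree_metric A E' dist',
      [/\ degree E a = (degree E' a + n)%N, degree E' b = (degree E b + n)%N
        & forall v, v != a -> v != b -> degree E' v = degree E v],
      transmission A mu dist' b <= transmission A mu dist' a,
      dist_cost A mu dist' <= dist_cost A mu dist
    & (0 < n)%N -> dist_cost A mu dist' < dist_cost A mu dist].
Proof.
move=> tmE aA bA nab mu_ge0.
elim: n E dist tmE => [|n IHn] E dist tmE pend tr ltn.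
  by exists E, dist; split=> //; split; rewrite ?addn0.
have [p [ap dp others]] := tm_parent tmE aA bA nab.
(* The bound on [n] leaves a neighbour of [a] besides its parent toward [b]; the branch at such a
   neighbour avoids [b]. *)
have : (0 < #|[set v | adj E a v] :\ p|)%N.
  by move: ltn; rewrite /degree (cardsD1 p) inE ap; nat_lia.
case/card_gt0P=> x; rewrite !inE => /andP[nxp ax].
have bX : b \notin branch A dist a x by rewrite inE bA (others x ax nxp); nat_lia.
set E1 := move_branch E a b x; set dist1 := move_dist A dist a b x.
have tm1 : tree_metric A E1 dist1 := move_tree_metric tmE ax bA bX.
have da : degree E a = (degree E1 a).+1 := degree_move_from tmE ax bX nab.
have db : degree E1 b = (degree E b).+1 := degree_move_to tmE ax bX nab.
have dv v : v != a -> v != b -> degree E1 v = degree E v.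
  exact: (degree_move_other tmE ax bX nab).
have from v : v \in A -> (dist a v <= dist1 a v)%N .
  exact: (move_dist_from tmE _ ax).
have to v : v \in A -> (dist1 b v <= dist b v)%N .
  exact: (move_dist_to tmE ax bA bX).
have tr1 : transmission A mu dist1 b <= transmission A mu dist1 a.
  apply: le_trans (_ : transmission A mu dist b <= _); last apply: le_trans tr _.
    by apply: ler_sum => v vA; rewrite ler_wpM2l ?mu_ge0 ?ler_nat ?to.
  by apply: ler_sum => v vA; rewrite ler_wpM2l ?mu_ge0 ?ler_nat ?from.
have lt1 : dist_cost A mu dist1 < dist_cost A mu dist.
  rewrite (dist_cost_move mu tmE ax bA bX) /=.
  set g := \sum_(v in _) _; set k : R := (dist a b)%:R.
  have k_gt0 : 0 < k by rewrite ltr0n (dist_gt0 tmE).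
  suff g_gt0 : 0 < g.
    have gk_gt0 := mulr_gt0 g_gt0 k_gt0.
    by rewrite gtrDl pmulr_rlt0 ?ltr0n // pmulr_rlt0 //; lra.
  have [u uX du] := branch_pendent tmE ax.
  have uA := branch_mem uX.
  rewrite /g (bigD1 u) //= ltr_pwDl //; last first.
    by apply: sumr_ge0 => v /andP[/branch_mem vA _]; apply: mu_ge0.
  apply: pend => //; first by apply: contraTneq uX => ->; apply: (branch_base tmE).
  by apply: contraNneq bX => <-.
have [v vA nva nvb|||E2 [dist2 [tm2 [da2 db2 dv2] tr2 le2 _]]] := IHn E1 dist1 tm1.
- by rewrite dv //; apply: pend.
- exact: tr1.
- by rewrite da in ltn.
exists E2, dist2; split=> //.
- split; [by rewrite da da2 addnS|by rewrite db2 db addnS addSn|].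
  by move=> v nva nvb; rewrite dv2 ?dv.
- exact: le_trans le2 (ltW lt1).
- by move=> _; apply: le_lt_trans le2 lt1.
Qed.

End Cost.

(** * Optimal trees contain a minimal star *)

Section Optimal.
Variables (R : realFieldType) (V : finType).
Implicit Types (A L X : {set V}) (E : {set {set V}}) (dist : V -> V -> nat).
Implicit Types (a b m u v w x y : V) (mu : V -> R) (d : V -> nat).

Definition realizes_on A d E : Prop :=
  tree_metric A E (tree_dist E) /\ forall v, v \in A -> degree E v = d v.

Definition cost A mu E : R := dist_cost A mu (tree_dist E).

Definition optimal A mu d E : Prop := is_argmin (realizes_on A d) (cost A mu) E.

Record tuple_on A mu d : Prop := TupleOn {
  tuple_ge0 : forall v, v \in A -> 0 <= mu v;
  tuple_deg : forall v, v \in A -> (0 < d v)%N;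
  tuple_sum : (\sum_(v in A) d v = 2 * (#|A| - 1))%N;
  tuple_mono : forall m m', m \in internal A d -> m' \in internal A d ->
     (d m < d m')%N -> mu m <= mu m';
  tuple_pos : forall v, v \in pendent A d -> 0 < mu v }.

Lemma tree_metric_tree_dist A E dist :
  tree_metric A E dist -> tree_metric A E (tree_dist E).
Proof.
move=> tmE; have dE := tree_metric_dist tmE; split.
- exact: tm_edge tmE.
- by move=> u uA; rewrite dE ?(tm_id tmE).
- by move=> u v uA vA; rewrite !dE ?(tm_sym tmE uA).
move=> u v uA vA nuv; have [w [uw dw others]] := tm_parent tmE uA vA nuv.
have wA := adj_memr tmE uw.
exists w; split=> // [|t ut ntw]; rewrite !dE //; last exact: (adj_memr tmE ut).
exact: others.
Qed.

Lemma costE A E mu dist : tree_metric A E dist -> cost A mu E = dist_cost A mu dist.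
Proof. by move=> tmE; apply: eq_dist_cost => u v; apply: tree_metric_dist. Qed.

Lemma mem_internal A d v : (v \in internal A d) = (v \in A) && (d v != 1%N).
Proof. by rewrite !inE; case: (v \in A) => //=; rewrite andbT. Qed.

Lemma mem_pendent A d v : (v \in pendent A d) = (v \in A) && (d v == 1%N).
Proof. by rewrite inE. Qed.

(** For each target at most one neighbour of [m] is closer than [m], so the two distances sum to at
    least twice that of [m]. The target [m] itself contributes the extra term. *)
Lemma transmission_convex A E dist mu m u v : tree_metric A E dist ->
  (forall t, t \in A -> 0 <= mu t) -> adj E m u -> adj E m v -> u != v ->
  2 * (transmission A mu dist m + mu m)
    <= transmission A mu dist u + transmission A mu dist v.
Proof.
move=> tmE mu_ge0 mu_ mv nuv; have mA := adj_meml tmE mu_.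
rewrite -(sum_point mu mA) /transmission -!big_split /= mulr_sumr.
apply: ler_sum => t tA; rewrite -mulrDr [_%:R * mu t]mulrC -mulrDr mulrCA.
apply: ler_wpM2l; first exact: mu_ge0.
rewrite -!natrD -natrM ler_nat.
have [->|ntm] := eqVneq t m.
  have [uA vA] := (adj_memr tmE mu_, adj_memr tmE mv).
  move: mu_ mv; rewrite !(adj_dist1 tmE) // !(tm_sym tmE mA) // => /eqP-> /eqP->.
  by rewrite (tm_id tmE).
have [|p [_ _ others]] := tm_parent tmE mA tA; first by rewrite eq_sym.
have := dist_adj tmE tA mu_; have := dist_adj tmE tA mv.
have [eup|/(others u mu_)] := eqVneq u p; last by nat_lia.
have nvp : v != p by rewrite -eup eq_sym.
by have := others v mv nvp; nat_lia.
Qed.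

Section OptimalTree.
Variables (A : {set V}) (mu : V -> R) (d : V -> nat) (E : {set {set V}}).
Hypotheses (tupleA : tuple_on A mu d) (optE : optimal A mu d E).
Let dist := tree_dist E.
Let D := transmission A mu dist.
Let tmE : tree_metric A E dist. Proof. by case: optE => [[]]. Qed.
Let degE v : v \in A -> degree E v = d v.
Proof. by case: optE => [[_ dE] _]; apply: dE. Qed.
Let mu_ge0 v : v \in A -> 0 <= mu v. Proof. exact: (tuple_ge0 tupleA). Qed.

Lemma optimal_dist E' dist' : tree_metric A E' dist' ->
  (forall v, v \in A -> degree E' v = d v) ->
  dist_cost A mu dist <= dist_cost A mu dist'.
Proof.
move=> tm' deg'; case: optE => _ /(_ E').
rewrite (costE mu tm'); apply; split=> //; exact: tree_metric_tree_dist tm'.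
Qed.

(** Sending the [d m - d b] excess branches from [m] to [b] exchanges the two degrees; swapping the
    labels restores them and brings the heavier weight to the more central place. Neither operation
    raises the cost, so optimality makes both trivial. *)
Lemma optimal_no_swap m b : m \in A -> b \in A -> m != b -> d b != 1%N ->
  D b <= D m -> mu b <= mu m -> (d b <= d m)%N -> mu m = mu b /\ d m = d b.
Proof.
move=> mA bA nmb db1 leD lemu led.
have dm : degree E m = d m := degE mA.
have db : degree E b = d b := degE bA.
have db0 := tuple_deg tupleA bA.
have [v vA nvm nvb dv|||E1 [dist1 [tm1 [dm1 db1' dv1] tr1 le1 lt1]]] :=
  move_branches (n := d m - d b) (mu := mu) tmE mA bA nmb mu_ge0.
- by apply: (tuple_pos tupleA); rewrite mem_pendent vA -degE // dv.
- exact: leD.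
- by rewrite dm; nat_lia.
have deg2 v : v \in A -> degree (relabel m b E1) v = d v.
  move=> vA.
  rewrite degree_relabel; case: tpermP => [->|->|/eqP nvm /eqP nvb].
  - by rewrite db1' db subnKC.
  - by nat_lia.
  - by rewrite dv1 ?degE.
have := optimal_dist (relabel_tree_metric tm1 mA bA) deg2.
rewrite dist_cost_relabel // (dist_cost_tperm mu tm1 mA bA nmb).
set k : R := (dist1 m b)%:R; have k_gt0 : 0 < k by rewrite ltr0n (dist_gt0 tm1).
move=> le2.
have w_ge0 : 0 <= mu m - mu b by rewrite subr_ge0.
set w := mu m - mu b in le2 w_ge0.
have wD : w * (transmission A mu dist1 b - transmission A mu dist1 m) <= 0.
  by rewrite mulr_ge0_le0 // subr_le0.
have wwk : 0 <= w ^+ 2 * k by rewrite mulr_ge0 ?sqr_ge0 ?ltW.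
split; last first.
  apply/eqP/contraT => ne.
  have /lt1 : (0 < d m - d b)%N by rewrite subn_gt0 ltn_neqAle eq_sym ne.
  by lra.
have : w ^+ 2 * k = 0 by lra.
by move/eqP; rewrite mulf_eq0 sqrf_eq0 (gt_eqF k_gt0) orbF subr_eq0 => /eqP.
Qed.

Lemma optimal_far_center m b : m \in internal A d -> b \in internal A d ->
  D b <= D m -> mu m <= mu b /\ (mu m = mu b -> (d m <= d b)%N).
Proof.
move=> mI bI leD; have [->//|nmb] := eqVneq m b.
move: (mI) (bI); rewrite !mem_internal => /andP[mA dm1] /andP[bA db1].
have no_swap := optimal_no_swap mA bA nmb db1 leD.
split.
  rewrite leNgt; apply/negP => ltmu.
  (* Degree-monotonicity: a strictly lighter [b] cannot have the larger degree. *)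
  have led : (d b <= d m)%N.
    by rewrite leqNgt; apply/negP => /(tuple_mono tupleA mI bI); rewrite leNgt ltmu.
  by have [e _] := no_swap (ltW ltmu) led; rewrite e ltxx in ltmu.
move=> emu; case: (leqP (d m) (d b)) => // ltd.
by have [|_ e] := no_swap _ (ltnW ltd); [rewrite emu | rewrite e ltnn in ltd].
Qed.

(** From [l] every vertex is one step farther than from [m], except [l], which is one step
    nearer. *)
Lemma transmission_pendent l m : adj E m l -> d l = 1%N ->
  D l = D m + \sum_(v in A) mu v - 2 * mu l.
Proof.
move=> ml dl; have lA := adj_memr tmE ml; have mA := adj_meml tmE ml.
have lm : adj E l m by rewrite adj_sym.
rewrite -(sum_point mu lA) mulr_sumr /D /transmission -big_split -sumrB /=.
apply: eq_bigr => v vA; have [->|nvl] := eqVneq v l.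
  by move: ml; rewrite (adj_dist1 tmE) // => /eqP->; rewrite (tm_id tmE) //=; ring.
have dvE : dist l v = (dist m v).+1 by apply: (dist_pendent tmE); rewrite ?degE.
by rewrite dvE -natr1 /=; ring.
Qed.

Lemma optimal_far_pendent m b l y : m \in internal A d -> b \in internal A d ->
  m != b -> l \in pendent A d -> y \in pendent A d -> adj E m l -> adj E b y ->
  D b <= D m -> mu l <= mu y.
Proof.
rewrite !mem_internal !mem_pendent.
move=> /andP[mA dm1] /andP[bA db1] nmb /andP[lA /eqP dl] /andP[yA /eqP dy] ml b_y leD.
have nym : y != m by apply: contraNneq dm1 => <-; rewrite dy.
have nly : l != y.
  apply: contraNneq nmb => ely.
  have /eqP/cards1P[z zE] : degree E l = 1%N by rewrite degE.
  have : b \in [set z] by rewrite -zE inE adj_sym ely.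
  have : m \in [set z] by rewrite -zE inE adj_sym.
  by rewrite !inE => /eqP-> /eqP->.
(* Swapping the weights of [l] and [y] creates a term [2 * w ^+ 2] through their own contributions
   to the transmissions; a distance of at least 3, due to distinct neighbours [m] and [b], outweighs
   it. *)
have k_ge3 : (3 <= dist l y)%N.
  have lm : adj E l m by rewrite adj_sym.
  have yb : adj E y b by rewrite adj_sym.
  rewrite (dist_pendent tmE lm) ?degE //; last by rewrite eq_sym.
  rewrite (tm_sym tmE mA yA) (dist_pendent tmE yb) ?degE //; last by rewrite eq_sym.
  by rewrite !ltnS (dist_gt0 tmE) // eq_sym.
rewrite leNgt; apply/negP => ltmu.
have deg2 v : v \in A -> degree (relabel l y E) v = d v.
  move=> vA; rewrite degree_relabel.
  by case: tpermP => [->|->|_ _]; rewrite degE ?dl ?dy.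
have := optimal_dist (relabel_tree_metric tmE lA yA) deg2.
rewrite dist_cost_relabel // (dist_cost_tperm mu tmE lA yA nly).
rewrite -/D (transmission_pendent ml dl) (transmission_pendent b_y dy).
set k : R := (dist l y)%:R; have k3 : 3%:R <= k by rewrite ler_nat.
set w := mu l - mu y; have w_gt0 : 0 < w by rewrite subr_gt0.
have -> : D b + \sum_(v in A) mu v - 2 * mu y - (D m + \sum_(v in A) mu v - 2 * mu l)
    = (D b - D m) + 2 * w by rewrite /w; ring.
have wD : w * (D b - D m) <= 0 by rewrite pmulr_rle0 // subr_le0.
have w2k : w ^+ 2 * 3%:R <= w ^+ 2 * k by rewrite ler_wpM2l ?sqr_ge0.
have w2 : 0 < w ^+ 2 by rewrite exprn_gt0.
by rewrite mulrDr; lra.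
Qed.

Lemma optimal_minimal_star : (1 < #|internal A d|)%N ->
  exists m L, minimal_star A mu d m L /\ (forall l, l \in L -> adj E m l).
Proof.
move=> I_gt1.
have [m0 m0I] : exists m0, m0 \in internal A d by apply/card_gt0P; nat_lia.
have [m1 m1I m1_max] := Order.TotalTheory.arg_maxP D m0I.
pose top := [pred m in internal A d | D m == D m1].
have top1 : top m1 by apply/andP; split; [exact: m1I | exact: eqxx].
(* Ties are broken by the unweighted transmission, which is strictly convex:
   internal weights may vanish, and then [D] need not be. *)
have [m /andP[mI /eqP emD] m_max] :=
  Order.TotalTheory.arg_maxP (transmission A (fun=> 1 : R) dist) top1.
have far b : b \in internal A d -> D b <= D m by rewrite emD; apply: m1_max.
move: (mI); rewrite mem_internal => /andP[mA dm1].
have toward b : b \in A -> b != m ->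
    exists2 n, adj E m n & (n = b \/ n \in internal A d).
  move=> bA nbm; have [|n [mn dn _]] := tm_parent tmE mA bA; first by rewrite eq_sym.
  exists n => //; have nA := adj_memr tmE mn.
  have [->|nbn] := eqVneq n b; [by left | right].
  rewrite mem_internal nA; apply/eqP => dn1.
  have nm : adj E n m by rewrite adj_sym.
  have := dist_pendent tmE nm; rewrite degE // => /(_ _ dn1 bA).
  by rewrite eq_sym => /(_ nbn); nat_lia.
pose N := [set n | adj E m n].
have N1 : #|N :&: internal A d| = 1%N.
  have [n nI] : exists n, n \in N :&: internal A d.
    have [b] : exists b, b \in internal A d :\ m.
      by apply/card_gt0P; move: I_gt1; rewrite (cardsD1 m) mI; nat_lia.
    rewrite in_setD1 => /andP[nbm bI]; move: (bI); rewrite mem_internal => /andP[bA _].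
    have [n mn nI] := toward b bA nbm; exists n; rewrite inE [n \in N]inE mn.
    by case: nI => [->|].
  (* Two internal neighbours would, by convexity and maximality, both tie with [m] for [D]; strict
     convexity of the unweighted transmission then contradicts the tie-breaking choice of [m]. *)
  apply/eqP; rewrite (cardsD1 n) nI add1n eqSS cards_eq0 -subset0; apply/subsetP => n'.
  rewrite in_setD1 in_setI [n' \in N]inE => /and3P[nn' mn' n'I].
  move: nI; rewrite in_setI [n \in N]inE => /andP[mn nI].
  have nnn' : n != n' by rewrite eq_sym.
  have cvx := transmission_convex tmE mu_ge0 mn mn' nnn'.
  have cvx1 :=
    transmission_convex (mu := fun=> 1) tmE (fun _ _ => ler01) mn mn' nnn'.
  have := far n nI; have := far n' n'I; have := mu_ge0 mA.
  rewrite -/D in cvx => mu_m le' le.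
  have tie t : t \in internal A d -> D t = D m ->
      transmission A (fun=> 1 : R) dist t <= transmission A (fun=> 1) dist m.
    by move=> tI eDt; apply: m_max; apply/andP; split; rewrite ?eDt ?emD.
  have := tie n nI ltac:(lra); have := tie n' n'I ltac:(lra); lra.
pose L := [set l in pendent A d | adj E m l].
have cardL : #|L| = (d m - 1)%N.
  have <- : degree E m = d m by rewrite degE.
  rewrite -N1 /degree -/N -(cardsID (internal A d) N) addKn; congr #|pred_of_set _|.
  apply/setP => l; rewrite !inE.
  case: (boolP (adj E m l)) => [/(adj_memr tmE)->|_]; rewrite ?andbF //=.
  by case: (d l == 1%N).
exists m, L; split; last by move=> l; rewrite inE => /andP[].
split=> //.
- split; last first.
    move=> b [bI b_min]; have [leb] := optimal_far_center mI bI (far b bI).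
    by apply; apply/eqP; rewrite eq_le leb b_min.
  by split=> // b bI; have [] := optimal_far_center mI bI (far b bI).
- by apply/subsetP => l; rewrite inE => /andP[].
move=> l y; rewrite inE => /andP[lP ml]; rewrite in_setD => /andP[yL yP].
move: (yP); rewrite mem_pendent => /andP[yA /eqP dy].
have nym : y != m by apply: contraNneq dm1 => <-; rewrite dy.
have [b [yb _ _]] := tm_parent tmE yA mA nym.
have b_y : adj E b y by rewrite adj_sym.
have nmb : m != b by apply: contraNneq yL => emb; rewrite inE yP emb.
have bI : b \in internal A d.
  rewrite mem_internal (adj_memr tmE yb) -degE ?(adj_memr tmE yb) //.
  have := pendent_adj_neq2 tmE yb; rewrite degE // => /(_ _ dy mA).
  by rewrite eq_sym nym nmb => /(_ isT isT); nat_lia.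
exact: (optimal_far_pendent mI bI nmb lP yP ml b_y (far b bI)).
Qed.

End OptimalTree.
End Optimal.

(** * Induction on the number of internal vertices *)

(** Descent on the number of points of smaller value. This replaces the choice of a minimizer, [P]
    being a mere proposition. *)
Lemma argmin_lower_bound (R : realFieldType) (T : finType) (P : T -> Prop)
    (f : T -> R) (c : R) :
  (forall x, is_argmin P f x -> c <= f x) -> forall x, P x -> c <= f x.
Proof.
move=> le_argmin x; have [n] := ubnP #|[set y | f y < f x]|.
elim: n x => // n IHn x ltn Px; rewrite leNgt; apply/negP => ltx.
suff /le_argmin : is_argmin P f x by rewrite leNgt ltx.
split=> // y Py; rewrite leNgt; apply/negP => ltyx.
suff : c <= f y by rewrite leNgt (lt_trans ltyx ltx).
apply: IHn => //; move: ltn; rewrite ltnS; apply: leq_trans.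
apply: proper_card; apply/properP; split.
  by apply/subsetP => z; rewrite !inE => /lt_trans; apply.
by exists y; rewrite !inE ?ltxx.
Qed.

Section Induction.
Variables (R : realFieldType) (V : finType).
Implicit Types (A L X : {set V}) (E : {set {set V}}) (dist : V -> V -> nat).
Implicit Types (a b m u v w x y : V) (mu : V -> R) (d : V -> nat).

(** The share of the cost due to the edges of the star; it does not depend on the rest of the
    tree. *)
Definition star_cost A mu m L : R := \sum_(u in A) \sum_(v in A)
  mu u * mu v * (if u == v then 0 else (u \in L) + (v \in L))%N%:R.

(** The merged weight is the pushforward of [mu] under the collapse. *)
Lemma sum_shrink A mu m L (f : V -> R) : L \subset A -> m \in A :\: L ->
  \sum_(u in A) mu u * f (shrink m L u)
  = \sum_(w in A :\: L) merge_weight mu m L w * f w.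
Proof.
move=> LA mAL; have mL : m \notin L by move: mAL; rewrite inE => /andP[].
rewrite (big_setID L) /= (setIidPr LA) [RHS](bigD1 m) //= [X in _ + X = _](bigD1 m) //=.
rewrite addrA; congr (_ + _); last first.
  apply: eq_bigr => w /andP[]; rewrite inE => /andP[wL _] nwm.
  by rewrite /shrink (negPf wL) /merge_weight (negPf nwm).
rewrite /merge_weight eqxx big_setU1 //= addrC mulrDl {1}/shrink (negPf mL) mulr_suml.
by congr (_ + _); apply: eq_bigr => u uL; rewrite /shrink uL.
Qed.

Lemma dist_cost_star A E mu dist m L : tree_metric (A :\: L) E dist ->
  L \subset A -> m \in A :\: L ->
  dist_cost A mu (star_dist dist m L) =
  dist_cost (A :\: L) (merge_weight mu m L) dist + star_cost A mu m L.
Proof.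
move=> tmE LA mAL; set mu' := merge_weight mu m L.
have -> : dist_cost (A :\: L) mu' dist = \sum_(u in A) mu u *
    \sum_(w in A :\: L) mu' w * (dist (shrink m L u) w)%:R.
  rewrite (sum_shrink mu (fun u => \sum_(w in A :\: L) mu' w * (dist u w)%:R) LA mAL).
  apply: eq_bigr => u _; rewrite mulr_sumr.
  by apply: eq_bigr => w _; rewrite mulrA.
rewrite /dist_cost /star_cost -big_split; apply: eq_bigr => u uA /=.
rewrite -(sum_shrink mu (fun w => (dist (shrink m L u) w)%:R) LA mAL).
rewrite mulr_sumr -big_split; apply: eq_bigr => v vA /=.
rewrite /star_dist; case: eqVneq => [<-|_]; last by rewrite natrD; ring.
by rewrite (tm_id tmE) ?shrink_mem //; ring.
Qed.

Lemma realizes_onI A d E dist : tree_metric A E dist ->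
  (forall v, v \in A -> degree E v = d v) -> realizes_on A d E.
Proof. by move=> tmE degE; split=> //; apply: tree_metric_tree_dist tmE. Qed.

Lemma optimal_relabel A mu d E a b : a \in A -> b \in A -> mu a = mu b ->
  d a = d b -> optimal A mu d E -> optimal A mu d (relabel a b E).
Proof.
move=> aA bA emu ed [[tmE degE] minE]; have tm' := relabel_tree_metric tmE aA bA.
have same T (f : V -> T) : f a = f b -> f \o tperm a b =1 f.
  by move=> ef u /=; case: tpermP => [->|->|].
split.
  apply: realizes_onI tm' _ => v vA.
  by rewrite degree_relabel degE ?tperm_mem //; apply: same.
move=> E' /minE; rewrite [cost A mu (relabel a b E)](costE mu tm') dist_cost_relabel //.
congr (_ <= _); apply: eq_bigr => u _; apply: eq_bigr => v _.
by rewrite (same _ mu emu) (same _ mu emu).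
Qed.

Lemma minimal_star_center A mu d m L : minimal_star A mu d m L ->
  [/\ m \in A, d m != 1%N & m \notin L].
Proof.
case=> -[[]]; rewrite mem_internal => /andP[mA dm1] _ _ _ /subsetP LP _; split=> //.
by apply: contra dm1 => /LP; rewrite mem_pendent => /andP[].
Qed.

Lemma minimal_star_leaf A mu d m L l : minimal_star A mu d m L ->
  l \in L -> l \in A /\ d l = 1%N.
Proof.
by case=> _ _ /subsetP LP _ /LP; rewrite mem_pendent => /andP[lA /eqP].
Qed.

Lemma minimal_star_eq A mu d m L m' L' :
  minimal_star A mu d m L -> minimal_star A mu d m' L' ->
  mu m = mu m' /\ d m = d m'.
Proof.
case=> -[[mI mmin] dmin] _ _ _ [[[mI' mmin'] dmin'] _ _ _].
have emu : mu m = mu m' by apply/eqP; rewrite eq_le mmin ?mmin'.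
split=> //; apply/eqP; rewrite eqn_leq.
apply/andP; split; [apply: dmin | apply: dmin']; split=> // y yI.
Qed.

(** A leaf [x] in [L'] only and a leaf [y] in [L] only have equal weight, by minimality of both
    stars. Exchanging their labels keeps the tree optimal and brings [L'] closer to [L]. *)
Lemma optimal_star_leaves A mu d E m L L' :
  minimal_star A mu d m L -> minimal_star A mu d m L' ->
  optimal A mu d E -> (forall l, l \in L' -> adj E m l) ->
  exists2 E', optimal A mu d E' & forall l, l \in L -> adj E' m l.
Proof.
move=> starL; have [n] := ubnP #|L' :\: L|.
elim: n L' E => // n IHn L' E ltn starL' optE mL'.
have [sub|/subsetPn[y yL yL']] := boolP (L \subset L').
  by exists E => // l /(subsetP sub); apply: mL'.
have [_ cL LP minL] := starL; have [ctr cL' LP' minL'] := starL'.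
have [x xL' xL] : exists2 x, x \in L' & x \notin L.
  apply/subsetPn; apply: contraNN yL' => sub.
  have /eqP -> // : L' == L by rewrite eqEcard sub cL cL' leqnn.
have xP := subsetP LP' x xL'; have yP := subsetP LP y yL.
have emu : mu x = mu y.
  by apply/eqP; rewrite eq_le minL' ?minL // in_setD ?yP ?xP ?andbT.
have [[xA dx] [yA dy]] := (minimal_star_leaf starL' xL', minimal_star_leaf starL yL).
have [_ dm1 mL''] := minimal_star_center starL'.
have [_ _ mL] := minimal_star_center starL.
have nxy : x != y by apply: contraNneq yL' => <-.
apply: (IHn (y |: (L' :\ x)) (relabel x y E)).
- rewrite (cardsD1 x) inE xL xL' in ltn.
  suff -> : (y |: L' :\ x) :\: L = (L' :\: L) :\ x by [].
  apply/setP => z; rewrite !inE.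
  have [->|_] /= := eqVneq z y; first by rewrite yL andbF.
  by rewrite andbCA.
- split=> //.
  + rewrite cardsU1 !inE negb_and yL' orbT -cL'.
    by rewrite [in RHS](cardsD1 x) xL'.
  + rewrite subUset sub1set yP /=; apply: subset_trans LP'; exact: subsetDl.
  move=> u v; rewrite in_setU1 in_setD1 => u_in.
  rewrite in_setD in_setU1 in_setD1 => /andP[v_out vP].
  have [u' u'L' ->] : exists2 u', u' \in L' & mu u = mu u'.
    by case/orP: u_in => [/eqP->|/andP[_ uL']]; [exists x | exists u].
  have [vL'|vL'] := boolP (v \in L'); last by apply: minL'; rewrite // in_setD vL'.
  move: v_out; rewrite vL' andbT negb_or negbK => /andP[_ /eqP->].
  by rewrite emu; apply: minL'; rewrite // in_setD yL'.
- by apply: optimal_relabel; rewrite // dx dy.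
move=> l; rewrite in_setU1 in_setD1 adj_relabel.
have [nxm nym] : x != m /\ y != m.
  by split; [apply: contraNneq mL'' => <-|apply: contraNneq mL => <-].
rewrite (tpermD nxm nym) => /predU1P[->|/andP[nlx lL']]; first by rewrite tpermR mL'.
have nyl : y != l by apply: contraNneq yL' => ->.
by rewrite tpermD ?mL' // eq_sym.
Qed.

(** Centers of minimal stars agree in weight and degree, so a relabelling moves the star found in
    [E] to the center [m]; its leaves are then adjusted. *)
Lemma optimal_with_star A mu d E m L : tuple_on A mu d ->
  (1 < #|internal A d|)%N -> minimal_star A mu d m L -> optimal A mu d E ->
  exists E', [/\ optimal A mu d E', (forall l, l \in L -> adj E' m l)
                & cost A mu E' = cost A mu E].
Proof.
move=> tupleA I_gt1 starL optE.
have [m' [L' [starL' mL']]] := optimal_minimal_star tupleA optE I_gt1.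
have [emu ed] := minimal_star_eq starL' starL.
have [m'A dm' m'L'] := minimal_star_center starL'.
have [mA dm mL] := minimal_star_center starL.
have star' : minimal_star A mu d m L'.
  case: starL' => _ cL' LP' minL'; case: (starL) => ctr _ _ _.
  by split; rewrite // cL' ed.
have [||E' opt' mLE'] := optimal_star_leaves starL star' (E := relabel m' m E).
- exact: optimal_relabel.
- move=> l lL'; have [_ dl] := minimal_star_leaf starL' lL'.
  rewrite adj_relabel tpermR tpermD ?mL' //.
    by apply: contraNneq dm' => ->; rewrite dl.
  by apply: contraNneq dm => ->; rewrite dl.
exists E'; split=> //; apply/eqP; rewrite eq_le.
by case: opt' optE => [r' min'] [r min]; rewrite min' ?min.
Qed.

(** * Collapsing and re-expanding a minimal star *)

Section Step.
Variables (A : {set V}) (mu : V -> R) (d : V -> nat) (m : V) (L : {set V}).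
Hypotheses (tupleA : tuple_on A mu d) (starL : minimal_star A mu d m L).
Let mu' := merge_weight mu m L.
Let d' := merge_degree d m.
Let mA : m \in A. Proof. by case: (minimal_star_center starL). Qed.
Let mL : m \notin L. Proof. by case: (minimal_star_center starL). Qed.
Let dm1 : d m != 1%N. Proof. by case: (minimal_star_center starL). Qed.
Let mAL : m \in A :\: L. Proof. by rewrite inE mL. Qed.
Let cardL : (#|L| + 1 = d m)%N.
Proof. by case: starL => _ -> _ _; rewrite subnK ?(tuple_deg tupleA). Qed.
Let LA : L \subset A.
Proof. by apply/subsetP => l /(minimal_star_leaf starL)[]. Qed.

Lemma internal_merge : internal (A :\: L) d' = internal A d :\ m.
Proof.
apply/setP => v; rewrite in_setD1 !mem_internal inE /d' /merge_degree.
have [->|_] /= := eqVneq v m; first by rewrite andbF.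
by case: (boolP (v \in L)) => //= vL; have [-> ->] := minimal_star_leaf starL vL.
Qed.

(** The internal vertices only lose [m], which keeps monotonicity. The new pendent vertex [m] has
    positive weight because the star has at least one leaf, of positive weight. *)
Lemma tuple_merge : tuple_on (A :\: L) mu' d'.
Proof.
have mu_ge0 v : v \in A -> 0 <= mu v by apply: (tuple_ge0 tupleA).
have leaf_pos l : l \in L -> 0 < mu l.
  by case: starL => _ _ /subsetP LP _ /LP; apply: (tuple_pos tupleA).
split.
- move=> v; rewrite inE => /andP[_ vA]; rewrite /mu' /merge_weight.
  case: eqP => _; last exact: mu_ge0.
  by apply: sumr_ge0 => u /setU1P[->|/(subsetP LA)]; apply: mu_ge0.
- move=> v; rewrite inE /d' /merge_degree => /andP[_ vA].
  by case: eqP => // _; apply: (tuple_deg tupleA).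
- have := tuple_sum tupleA; rewrite (big_setID L) /= (setIidPr LA).
  rewrite (eq_bigr (fun _ => 1%N)); last by move=> l /(minimal_star_leaf starL)[].
  rewrite sum1_card (bigD1 m) //= [in X in _ -> X](bigD1 m) //=.
  rewrite /d' /merge_degree eqxx; set s := (\sum_(i in _ | _) d i)%N.
  rewrite [X in _ -> (1 + X)%N = _](_ : _ = s); last first.
    by apply: eq_bigr => v /andP[_ /negPf->].
  have := subset_leq_card LA; have : (0 < #|A :\: L|)%N by apply/card_gt0P; exists m.
  by rewrite cardsD (setIidPr LA); move: cardL; nat_lia.
- rewrite internal_merge => u v; rewrite !in_setD1 /d' /mu' /merge_degree /merge_weight.
  by move=> /andP[/negPf-> uI] /andP[/negPf-> vI]; apply: (tuple_mono tupleA).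
move=> v; rewrite mem_pendent inE /mu' /d' /merge_weight /merge_degree.
case: (v =P m) => [_ _|_ /andP[/andP[_ vA] dv]]; last first.
  by apply: (tuple_pos tupleA); rewrite mem_pendent vA.
have /card_gt0P[l lL] : (0 < #|L|)%N.
  by move/eqP: dm1; have := tuple_deg tupleA mA; move: cardL; clear; lia.
rewrite (bigD1 l) /=; last by rewrite inE lL orbT.
rewrite ltr_pwDl ?leaf_pos //; apply: sumr_ge0 => u /andP[/setU1P[->|uL] _].
  exact: mu_ge0.
exact/ltW/leaf_pos.
Qed.

Lemma realizes_add_star E : realizes_on (A :\: L) d' E ->
  realizes_on A d (star_edges m L :|: E).
Proof.
case=> tmE degE; apply: realizes_onI (add_star tmE LA mAL) _ => v vA.
have [vL|vL] := boolP (v \in L).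
  rewrite (degree_add_star_leaf tmE mAL vL).
  by have [_ ->] := minimal_star_leaf starL vL.
have [->|nvm] := eqVneq v m.
  by rewrite (degree_add_star_center tmE mAL) degE // /d' /merge_degree eqxx.
by rewrite degree_add_star_other // degE ?inE ?vL // /d' /merge_degree (negPf nvm).
Qed.

Lemma cost_add_star E : realizes_on (A :\: L) d' E ->
  cost A mu (star_edges m L :|: E) = cost (A :\: L) mu' E + star_cost A mu m L.
Proof.
case=> tmE _; rewrite (costE mu (add_star tmE LA mAL)).
exact: dist_cost_star tmE LA mAL.
Qed.

Lemma star_edgesK E : (forall l, l \in L -> adj E m l) ->
  star_edges m L :|: (E :\: star_edges m L) = E.
Proof.
move=> mLE; rewrite -[RHS](setID E (star_edges m L)); congr (_ :|: _).
exact/esym/setIidPr/star_edges_sub.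
Qed.

Lemma realizes_remove_star E : realizes_on A d E ->
  (forall l, l \in L -> adj E m l) ->
  realizes_on (A :\: L) d' (E :\: star_edges m L).
Proof.
case=> tmE degE mLE.
have dL l : l \in L -> degree E l = 1%N.
  by move=> /(minimal_star_leaf starL)[lA dl]; rewrite degE.
have tm' := remove_star tmE mLE dL.
apply: (realizes_onI tm') => v; rewrite inE => /andP[vL vA].
have := degE v vA; rewrite -[in degree E v](star_edgesK mLE) /d' /merge_degree.
have [->|nvm] := eqVneq v m; last by rewrite degree_add_star_other.
by rewrite (degree_add_star_center tm' mAL) -cardL => /addnI.
Qed.

Lemma optimal_remove_star E : optimal A mu d E ->
  (forall l, l \in L -> adj E m l) ->
  optimal (A :\: L) mu' d' (E :\: star_edges m L).
Proof.
move=> [rE minE] mLE; have r' := realizes_remove_star rE mLE; split=> // E' rE'.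
have := minE _ (realizes_add_star rE').
by rewrite cost_add_star // -{1}(star_edgesK mLE) cost_add_star // lerD2r.
Qed.

(** It suffices to compare with optimal trees, and each of these has the cost of one containing the
    prescribed star, where the comparison takes place after collapsing. *)
Lemma optimal_add_star E : (1 < #|internal A d|)%N ->
  optimal (A :\: L) mu' d' E -> optimal A mu d (star_edges m L :|: E).
Proof.
move=> I_gt1 [rE minE]; split; first exact: realizes_add_star.
apply: argmin_lower_bound => E0 optE0.
have [E1 [[r1 min1] mL1 <-]] := optimal_with_star tupleA I_gt1 starL optE0.
have r' := realizes_remove_star r1 mL1.
by rewrite -(star_edgesK mL1) !cost_add_star // lerD2r minE.
Qed.

End Step.

(** Every pendent vertex must be attached to the only internal one. Conversely, the degree of the
    center of that star is right because the degree sum fixes it. *)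
Lemma realizes_one_internal A mu d m : tuple_on A mu d -> internal A d = [set m] ->
  forall E, realizes_on A d E <-> E = star_edges m (A :\ m).
Proof.
move=> tupleA I1 E.
have : m \in internal A d by rewrite I1 set11.
rewrite mem_internal => /andP[mA dm1].
have pend v : v \in A -> v != m -> d v = 1%N.
  move=> vA; apply: contraNeq => dv.
  have : v \in internal A d by rewrite mem_internal vA.
  by rewrite I1 inE.
have A_m : A :\: (A :\ m) = [set m].
  apply/setP => v; rewrite !inE negb_and negbK.
  by case: eqP => [->|] //=; case: (v \in A).
have tm0 : tree_metric (A :\: (A :\ m)) set0 (fun _ _ => 0%N).
  by rewrite A_m; apply: singleton_tree_metric.
have mAm : m \in A :\: (A :\ m) by rewrite A_m set11.
have deg0 v : degree (set0 : {set {set V}}) v = 0%N.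
  by rewrite /degree eq_card0 // => t; rewrite inE /adj inE.
split=> [[tmE degE]|->].
  have mAE l : l \in A :\ m -> adj E m l.
    rewrite !inE => /andP[nlm lA].
    have [p [lp _ _]] := tm_parent tmE lA mA nlm.
    have [<-|npm] := eqVneq p m; first by rewrite adj_sym.
    have pA := adj_memr tmE lp.
    have := pendent_adj_neq2 tmE lp; rewrite !degE ?pend // => /(_ _ erefl mA).
    by rewrite !(eq_sym m) nlm npm => /(_ isT isT).
  have dL l : l \in A :\ m -> degree E l = 1%N.
    by rewrite !inE => /andP[nlm lA]; rewrite degE ?pend.
  have tm' := remove_star tmE mAE dL.
  rewrite -[LHS](star_edgesK mAE); suff -> : E :\: star_edges m (A :\ m) = set0.
    by rewrite setU0.
  apply/eqP; rewrite -subset0; apply/subsetP => e /(tm_edge tm').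
  rewrite A_m => /andP[/subset_leq_card le1 /eqP card_e].
  by rewrite card_e cards1 in le1.
have := add_star tm0 (subsetDl A [set m]) mAm; rewrite setU0 => tmS.
apply: realizes_onI tmS _ => v vA; rewrite -[star_edges _ _]setU0.
have [->|nvm] := eqVneq v m; last first.
  by rewrite (degree_add_star_leaf tm0 mAm) ?pend // !inE nvm.
rewrite (degree_add_star_center tm0 mAm) deg0 addn0.
have := tuple_sum tupleA; rewrite (bigD1 m) //= (eq_bigr (fun _ => 1%N)); last first.
  by move=> u /andP[uA num]; rewrite pend.
rewrite sum1_card (eq_card (B := A :\ m)); last by move=> u; rewrite !inE andbC.
by rewrite (cardsD1 m A) mA; nat_lia.
Qed.

Lemma huffmanE A mu d E : huffman A mu d E ->
  (exists2 m, internal A d = [set m] & E = star_edges m (A :\ m)) \/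
  (exists m L E', [/\ (1 < #|internal A d|)%N, minimal_star A mu d m L,
      huffman (A :\: L) (merge_weight mu m L) (merge_degree d m) E'
    & E = star_edges m L :|: E']).
Proof.
case=> [A' mu' d' m I1|A' mu' d' m L E' I_gt1 starL hE']; first by left; exists m.
by right; exists m, L, E'.
Qed.

Lemma optimal_huffman A mu d E : tuple_on A mu d -> (0 < #|internal A d|)%N ->
  optimal A mu d E <-> huffman A mu d E.
Proof.
have [n] := ubnP #|internal A d|; elim: n A mu d E => // n IHn A mu d E ltn tupleA.
rewrite leq_eqVlt => /predU1P[I1|I_gt1].
  have [m Im] : exists m, internal A d = [set m] by apply/cards1P; rewrite -I1.
  have rE := realizes_one_internal tupleA Im; split=> [[/rE-> _]|].
    exact: HuffmanLast.
  case/huffmanE=> [[m' Im' ->]|[m' [L [E' []]]]]; last by rewrite -I1.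
  have -> : m' = m by apply/set1P; rewrite -Im Im' set11.
  by split=> [|E' /rE->]; first exact/rE.
have IH m L E' : minimal_star A mu d m L ->
    optimal (A :\: L) (merge_weight mu m L) (merge_degree d m) E' <->
    huffman (A :\: L) (merge_weight mu m L) (merge_degree d m) E'.
  move=> starL; have mI : m \in internal A d by case: starL => -[[]].
  rewrite (cardsD1 m) mI in ltn I_gt1.
  by apply: IHn; rewrite ?(internal_merge starL) //; apply: tuple_merge.
split=> [optE|].
  have [m [L [starL mL]]] := optimal_minimal_star tupleA optE I_gt1.
  rewrite -(star_edgesK mL); apply: HuffmanStep => //; apply/IH => //.
  exact: optimal_remove_star.
case/huffmanE=> [[m Im _]|[m [L [E' [_ starL hE' ->]]]]].
  by rewrite Im cards1 in I_gt1.
by apply: optimal_add_star => //; apply/IH.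
Qed.

End Induction.

(** * Transfer to connected acyclic graphs and [VWWI] *)

Lemma realizes_setT (V : finType) (d : V -> nat) (E : {set {set V}}) :
  realizes d E <-> realizes_on [set: V] d E.
Proof.
split=> [[treeE degE]|[tmE degE]].
  by split=> [|v _]; [apply: is_tree_metric | apply: degE].
by split=> [|v]; [apply: tree_metric_is_tree tmE | apply: degE].
Qed.

Lemma VWWI_cost (R : realFieldType) (V : finType) (mu : V -> R) (E : {set {set V}}) :
  VWWI mu E = 2%:R^-1 * cost [set: V] mu E.
Proof.
congr (_ * _); rewrite /cost /dist_cost; apply: eq_big => [u|u _]; rewrite ?inE //.
by apply: eq_bigl => v; rewrite inE.
Qed.

Theorem theorem1 (R : realFieldType) (V : finType) (mu : V -> R) (d : V -> nat)
    (hgen : generating_tuple mu d)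
    (hW : (2 <= #|pendent [set: V] d|)%N)
    (hM : (1 <= #|internal [set: V] d|)%N)
    (hmono : degree_monotone mu d)
    (E : {set {set V}}) :
  is_argmin (realizes d) (VWWI mu) E <-> huffman_tree mu d E.
Proof.
have tupleT : tuple_on [set: V] mu d.
  case: hgen hmono => mu_ge0 d_gt0 sum_d [mono pos]; split=> //.
  by rewrite cardsT -sum_d; apply: eq_bigl => v; rewrite inE.
have half_gt0 : 0 < 2%:R^-1 :> R by rewrite invr_gt0 ltr0n.
rewrite /huffman_tree -(optimal_huffman E tupleT hM).
split=> -[/realizes_setT rE minE]; split=> // E' /realizes_setT /minE;
  by rewrite !VWWI_cost ler_pM2l.
Qed.
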